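(* Let $\mathcal{X}$ and $\mathcal{Y}$ be reflexive real Banach spaces, let $\varphi\in\Gamma_0(\mathcal{X})$, let $\psi\in\Gamma_0(\mathcal{Y})$ be Gâteaux differentiable on $\operatorname{int}\operatorname{dom}\psi\neq\varnothing$, and let $L\colon\mathcal{X}\to\mathcal{Y}$ be a bounded linear operator. Let $S$ be the set of solutions to the problem of minimizing $\varphi(x)+\psi(Lx)$ over $x\in\mathcal{X}$. Let $f\in\Gamma_0(\mathcal{X})$ be a Legendre function such that $S\cap\operatorname{int}\operatorname{dom}f\neq\varnothing$, $L(\operatorname{int}\operatorname{dom}f)\subset\operatorname{int}\operatorname{dom}\psi$, and $f\succcurlyeq\beta\,\psi\circ L$ for some $\beta\in\,]0,+\infty[$. Suppose that either $f$ is cofinite or $-L^*(\operatorname{ran}\nabla\psi)\subset\operatorname{dom}\varphi^*$, and that, for every $x\in\operatorname{int}\operatorname{dom}f$, $D^f(x,\cdot)$ is coercive. Let $\varepsilon\in\,]0,\beta/(\beta+1)[$, let $(\eta_n)_{n\in\mathbb{N}}\in\ell^1_+(\mathbb{N})$, and let $(\gamma_n)_{n\in\mathbb{N}}$ be a sequence in $\mathbb{R}$ such that $$(\forall n\in\mathbb{N})\quad \varepsilon\leq\gamma_n\leq\beta(1-\varepsilon)\quad\text{and}\quad (1+\eta_n)\gamma_n-\gamma_{n+1}\leq\beta\eta_n.$$ Let $x_0\in\operatorname{int}\operatorname{dom}f$ and iterate $$(\forall n\in\mathbb{N})\quad x_{n+1}=\operatorname{Prox}^{f}_{\gamma_n\varphi}\big(\nabla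 f(x_n)-\gamma_nL^*\nabla\psi(Lx_n)\big).$$ Then there exists $\overline{x}\in S$ such that the following hold. (i) Suppose that one of the following holds: (a) $S\cap\overline{\operatorname{dom}}f$ is a singleton; (b) $\nabla f$ and $\nabla\psi$ are weakly sequentially continuous and $S\subset\operatorname{int}\operatorname{dom}f$; (c) $\operatorname{dom}f^*$ is open and $\nabla f$, $\nabla f^*$, and $\nabla\psi$ are weakly sequentially continuous. Then $x_n\rightharpoonup\overline{x}$. (ii) Suppose that $f$ satisfies the condition that, for all bounded sequences $(u_n)_{n\in\mathbb{N}}$ and $(v_n)_{n\in\mathbb{N}}$ in $\operatorname{int}\operatorname{dom}f$, $D^f(u_n,v_n)\to0\Rightarrow u_n-v_n\to0$, and that one of the following holds: (a) $\varphi$ is uniformly convex at $\overline{x}$; (b) $\psi$ is uniformly convex at $L\overline{x}$ and there exists $\kappa\in\,]0,+\infty[$ such that $\|Lx\|\geq\kappa\|x\|$ for every $x\in\mathcal{X}$; (c) $\varliminf D^f_S(x_n)=0$. Then $x_n\to\overline{x}$.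
   Context: Notation. $\mathcal{X}^*$ is the topological dual of $\mathcal{X}$, $\langle\cdot,\cdot\rangle$ is the duality pairing, $L^*\colon\mathcal{Y}^*\to\mathcal{X}^*$ is the adjoint of $L$; $\rightharpoonup$ and $\to$ denote weak and strong convergence. $\ell^1_+(\mathbb{N})$ is the set of summable sequences in $[0,+\infty[$. $\Gamma_0(\mathcal{X})$ is the class of lower semicontinuous convex functions $h\colon\mathcal{X}\to\,]-\infty,+\infty]$ with $\operatorname{dom}h=\{x: h(x)<+\infty\}\neq\varnothing$. $\overline{\operatorname{dom}}h$ is the closure of $\operatorname{dom}h$. $h^*(x^* )=\sup_{x}(\langle x,x^*\rangle-h(x))$ is the conjugate; $h$ is cofinite if $\operatorname{dom}h^*=\mathcal{X}^*$; $h$ is coercive if $h(x)\to+\infty$ as $\|x\|\to+\infty$. $\nabla h$ is the Gâteaux gradient, defined on $\operatorname{int}\operatorname{dom}h$ (so $\operatorname{ran}\nabla\psi=\nabla\psi(\operatorname{int}\operatorname{dom}\psi)$). A gradient is weakly sequentially continuous if it maps sequences converging weakly to a point (sequence and limit in its domain of definition) to sequences converging weakly to the image of that point. $\partial h(x)=\{x^*\in\mathcal{X}^*:(\forall y\in\mathcal{X})\ \langle y-x,x^*\rangle+h(x)\leq h(y)\}$ is the subdifferential, and $\operatorname{dom}\partial h=\{x:\partial h(x)\neq\varnothing\}$. A solution of the minimization problem is a point at which the objective attains its minimum with a finite value. Legendre functions. $h\in\Gamma_0(\mathcal{X})$ that is Gâteaux differentiable on $\operatorname{int}\operatorname{dom}h\neq\varnothing$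 is a Legendre function if it is essentially smooth ($\partial h$ is both locally bounded and single-valued on its domain) and essentially strictly convex ($\partial h^*$ is locally bounded on its domain and $h$ is strictly convex on every convex subset of $\operatorname{dom}\partial h$). Bregman distance. For $h$ Gâteaux differentiable on $\operatorname{int}\operatorname{dom}h\neq\varnothing$, $D^h(x,y)=h(x)-h(y)-\langle x-y,\nabla h(y)\rangle$ if $y\in\operatorname{int}\operatorname{dom}h$ and $D^h(x,y)=+\infty$ otherwise. For a closed convex set $C$, $D^h_C(y)=\inf_{x\in C}D^h(x,y)$. Order. $f\succcurlyeq\beta\,\psi\circ L$ means $D^f(x,y)\geq\beta D^\psi(Lx,Ly)$ for all $x\in\operatorname{dom}f$ and $y\in\operatorname{int}\operatorname{dom}f$. Proximity operator. For $h,\phi\in\Gamma_0(\mathcal{X})$, $\operatorname{Prox}^h_\phi\colon\mathcal{X}^*\to2^{\mathcal{X}}$ maps $x^*$ to the set of $x\in\mathcal{X}$ such that $\phi(x)+h(x)-\langle x,x^*\rangle=\min(\phi+h-x^* )(\mathcal{X})<+\infty$. Writing $x_{n+1}=\operatorname{Prox}^{f}_{\gamma_n\varphi}(\cdot)$ means that $x_{n+1}$ is the unique element of that set. Uniform convexity. $h$ is uniformly convex at $x\in\operatorname{dom}h$ if there is an increasing function $\phi\colon[0,+\infty[\to[0,+\infty]$ vanishing only at $0$ such that for all $y\in\operatorname{dom}h$ and $t\in\,]0,1[$, $h(tx+(1-t)y)+t(1-t)\phi(\|x-y\|)\leq th(x)+(1-t)h(y)$. *)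

(* Defs.v *)
From HB Require Import structures.
From mathcomp Require Import all_boot all_order all_algebra.
From mathcomp Require Import all_classical all_reals interval_inference.
From mathcomp Require Import ereal topology convex normedtype sequences derive.

Set Implicit Arguments.
Unset Strict Implicit.
Unset Printing Implicit Defensive.

Import Order.TTheory GRing.Theory Num.Theory.
Import numFieldNormedType.Exports.

Local Open Scope classical_set_scope.
Local Open Scope ring_scope.

Section BoundedOperators.
Variables (R : realType) (X Y : normedModType R).

Definition bounded_linear : {pred X -> Y} :=
  fun T => `[< linear T /\ continuous T >].

Lemma bounded_linear_submod_closed : submod_closed bounded_linear.
Proof.
split.
  apply/asboolP; split=> [a u v|]; first by rewrite /= scaler0 addr0.
  exact: cst_continuous.
move=> a S T /asboolP[linS cS] /asboolP[linT cT]; apply/asboolP; split.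
  move=> b u v; rewrite !fctE linS linT !scalerDr !scalerA mulrC.
  by rewrite addrACA.
move=> x; apply: cvgD; last exact: cT.
by apply: cvgZl_tmp; exact: cS.
Qed.

HB.instance Definition _ :=
  GRing.isSubmodClosed.Build R (X -> Y) bounded_linear
    bounded_linear_submod_closed.

Record bounded_operator := BoundedOperator {
  operator_fun :> X -> Y;
  _ : operator_fun \in bounded_linear }.

HB.instance Definition _ := [isSub for operator_fun].
HB.instance Definition _ := [Choice of bounded_operator by <:].
HB.instance Definition _ :=
  [SubChoice_isSubLmodule of bounded_operator by <:].

Lemma bounded_operator_linear (T : bounded_operator) : linear T.
Proof. by case: T => T /= /asboolP[]. Qed.

Lemma bounded_operator_continuous (T : bounded_operator) : continuous T.
Proof. by case: T => T /= /asboolP[]. Qed.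

HB.instance Definition _ (T : bounded_operator) :=
  GRing.isLinear.Build R X Y *:%R T (bounded_operator_linear T).

Definition operator_norm (T : bounded_operator) : R :=
  sup [set `|T x| | x in [set x | `|x| <= 1]].

Lemma operator_norm_has_sup (T : bounded_operator) :
  has_sup [set `|T x| | x in [set x | `|x| <= 1]].
Proof.
split; first by exists `|T 0|, 0; rewrite //= normr0.
have /linear_bounded_continuous/bounded_funP/(_ 1)[M TM] :=
  @bounded_operator_continuous T.
by exists M => _ [x x1 <-]; exact: TM.
Qed.

Lemma operator_norm_ub (T : bounded_operator) x :
  `|x| <= 1 -> `|T x| <= operator_norm T.
Proof.
move=> x1; apply: ub_le_sup; first by have [] := operator_norm_has_sup T.
by exists x.
Qed.

Lemma operator_norm_le (T : bounded_operator) M :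
  (forall x, `|x| <= 1 -> `|T x| <= M) -> operator_norm T <= M.
Proof.
move=> TM; apply: ge_sup; first by have [] := operator_norm_has_sup T.
by move=> _ [x x1 <-]; exact: TM.
Qed.

Lemma operator_norm_ge0 (T : bounded_operator) : 0 <= operator_norm T.
Proof.
by rewrite (le_trans _ (@operator_norm_ub T 0 _)) ?normr0// normr_ge0.
Qed.

Lemma operator_normD (S T : bounded_operator) :
  operator_norm (S + T) <= operator_norm S + operator_norm T.
Proof.
apply: operator_norm_le => x x1; rewrite /= (le_trans (ler_normD _ _))//.
by rewrite lerD// operator_norm_ub.
Qed.

Let operator_normZ_le (a : R) (T : bounded_operator) :
  operator_norm (a *: T) <= `|a| * operator_norm T.
Proof.
apply: operator_norm_le => x x1; rewrite /= normrZ ler_wpM2l//.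
exact: operator_norm_ub.
Qed.

Lemma operator_normZ (a : R) (T : bounded_operator) :
  operator_norm (a *: T) = `|a| * operator_norm T.
Proof.
apply/eqP; rewrite eq_le operator_normZ_le/=.
have [->|a0] := eqVneq a 0; first by rewrite normr0 mul0r operator_norm_ge0.
rewrite -ler_pdivlMl ?normr_gt0// -normfV.
rewrite -{1}(scale1r T) -(mulVf a0) -scalerA.
exact: operator_normZ_le.
Qed.

Lemma operator_norm_eq0 (T : bounded_operator) : operator_norm T = 0 -> T = 0.
Proof.
move=> T0; apply/val_inj/funext => x /=.
have [->|x0] := eqVneq x 0; first by rewrite linear0.
have : `|T (`|x|^-1 *: x)| <= operator_norm T.
  apply: operator_norm_ub.
  by rewrite normrZ normfV normr_id mulVf// normr_eq0.
rewrite T0 linearZ/= normr_le0 scaler_eq0 invr_eq0 normr_eq0 (negbTE x0)/=.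
by move/eqP.
Qed.

HB.instance Definition _ :=
  Lmodule_isNormed.Build R bounded_operator
    operator_normD operator_normZ operator_norm_eq0.

End BoundedOperators.

Definition dual (R : realType) (X : normedModType R) : normedModType R :=
  bounded_operator X R^o.

Section Adjoint.
Variables (R : realType) (X Y : normedModType R) (L : bounded_operator X Y).

Lemma adjoint_subproof (ys : dual Y) : (ys \o L) \in @bounded_linear R X R^o.
Proof.
apply/asboolP; split=> [a u v|x]; first by rewrite /= !linearP.
by apply: continuous_comp; exact: bounded_operator_continuous.
Qed.

Definition adjoint (ys : dual Y) : dual X :=
  BoundedOperator (adjoint_subproof ys).

End Adjoint.

Section Space.
Variables (R : realType) (X : normedModType R).

(* The canonical embedding of X into its bidual is onto. *)
Definition reflexive_space : Prop :=
  forall xss : dual (dual X), exists x : X, forall xs : dual X, xss xs = xs x.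

(* Convergence of a sequence for the weak topology. On [dual X] the test
   functionals are those of the bidual. *)
Definition weakly_cvg (u : nat -> X) (x : X) : Prop :=
  forall xs : dual X, (fun n => xs (u n)) @ \oo --> xs x.

End Space.

Section ConvexFunctions.
Variables (R : realType) (X : normedModType R).
Implicit Types (h phi : X -> \bar R) (x y : X) (C : set X) (xs : dual X).

Definition dom h : set X := [set x | (h x < +oo)%E].

Definition convex_efun h : Prop :=
  forall x y (t : R), 0 < t < 1 ->
    (h (t *: x + (1 - t) *: y)%R
      <= t%:E * h x + (1 - t)%R%:E * h y)%E.

Definition Gamma0 h : Prop :=
  [/\ lower_semicontinuous h, convex_efun h,
      forall x, (-oo < h x)%E & dom h !=set0].

Definition conjugate h : dual X -> \bar R :=
  fun xs => ereal_sup [set ((xs x)%:E - h x)%E | x in [set: X]].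

Definition coercive h : Prop :=
  forall a : R, exists b : R, forall x, b <= `|x| -> (a%:E <= h x)%E.

Definition subdiff h x : set (dual X) :=
  [set xs | forall y, ((xs (y - x)%R)%:E + h x <= h y)%E].

Definition dom_subdiff h : set X := [set x | subdiff h x !=set0].

(* Only meaningful at interior points of [dom h], around which a function in
   [Gamma0] is finite, so that [fine] is harmless. *)
Definition is_gateaux_gradient h x xs : Prop :=
  forall v : X, is_derive x v (fun y => fine (h y) : R^o) (xs v).

Definition gateaux_differentiable h : Prop :=
  (dom h)° !=set0 /\
  forall x, (dom h)° x -> exists xs, is_gateaux_gradient h x xs.

(* Total function; 0 where there is no Gateaux gradient. *)
Definition grad h x : dual X := xget 0 [set xs | is_gateaux_gradient h x xs].

Definition subdiff_locally_bounded h : Prop :=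
  forall x, dom_subdiff h x ->
    exists M : R, \forall y \near x, forall xs, subdiff h y xs -> `|xs| <= M.

Definition subdiff_single_valued h : Prop :=
  forall x xs xs', subdiff h x xs -> subdiff h x xs' -> xs = xs'.

Definition strictly_convex_on h C : Prop :=
  forall x y (t : R), C x -> C y -> x != y -> 0 < t < 1 ->
    (h (t *: x + (1 - t) *: y)%R
      < t%:E * h x + (1 - t)%R%:E * h y)%E.

Definition essentially_smooth h : Prop :=
  subdiff_locally_bounded h /\ subdiff_single_valued h.

Definition bregman h x y : \bar R :=
  if `[< (dom h)° y >] then (h x - h y - (grad h y (x - y)%R)%:E)%E else +oo%E.

Definition bregman_set h C y : \bar R :=
  ereal_inf [set bregman h x y | x in C].

Definition grad_weakly_seq_continuous h : Prop :=
  forall (u : nat -> X) x, (forall n, (dom h)° (u n)) -> (dom h)° x ->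
    weakly_cvg u x -> weakly_cvg (fun n => grad h (u n)) (grad h x).

Definition prox h phi xs : set X :=
  [set x | (phi x + h x - (xs x)%:E < +oo)%E /\
    forall y, (phi x + h x - (xs x)%:E <= phi y + h y - (xs y)%:E)%E].

(* The modulus lives on [0, +oo[; "increasing" is meant in the wide sense
   (it may take the value +oo). *)
Definition uniformly_convex_at h x : Prop :=
  dom h x /\
  exists phi : R -> \bar R,
    [/\ forall s, 0 <= s -> (0 <= phi s)%E,
        forall s t, 0 <= s -> s <= t -> (phi s <= phi t)%E,
        forall s, 0 <= s -> (phi s = 0%E <-> s = 0) &
        forall y (t : R), dom h y -> 0 < t < 1 ->
          (h (t *: x + (1 - t) *: y)%R + (t * (1 - t))%R%:E * phi `|x - y|%R
            <= t%:E * h x + (1 - t)%R%:E * h y)%E].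

Definition minimizers h : set X :=
  [set x | h x \is a fin_num /\ forall y, (h x <= h y)%E].

Definition bregman_seq_condition h : Prop :=
  forall u v : nat -> X,
    (forall n, (dom h)° (u n)) -> (forall n, (dom h)° (v n)) ->
    bounded_fun u -> bounded_fun v ->
    (fun n => bregman h (u n) (v n)) @ \oo --> 0%E ->
    (fun n => u n - v n) @ \oo --> (0 : X).

End ConvexFunctions.

Definition cofinite (R : realType) (X : normedModType R) (h : X -> \bar R) :
  Prop := dom (conjugate h) = [set: dual X].

Definition essentially_strictly_convex (R : realType) (X : normedModType R)
    (h : X -> \bar R) : Prop :=
  subdiff_locally_bounded (conjugate h) /\
  forall C : set X, convex_set (C : set (convex_lmodType X)) ->
    C `<=` dom_subdiff h -> strictly_convex_on h C.

Definition Legendre (R : realType) (X : normedModType R)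
    (h : X -> \bar R) : Prop :=
  [/\ Gamma0 h, gateaux_differentiable h, essentially_smooth h &
      essentially_strictly_convex h].

(* f >= beta (psi o L) in the Bregman order. *)
Definition bregman_dominates (R : realType) (X Y : normedModType R)
    (f : X -> \bar R) (beta : R) (psi : Y -> \bar R)
    (L : bounded_operator X Y) : Prop :=
  forall x y, dom f x -> (dom f)° y ->
    (beta%:E * bregman psi (L x) (L y) <= bregman f x y)%E.

(* Main.v *)
Require Import Defs.
From mathcomp Require Import all_boot all_order all_algebra.
From mathcomp Require Import all_classical all_reals interval_inference.
From mathcomp Require Import ereal topology convex normedtype sequences derive.
From HB Require Import structures.
From mathcomp Require Import ring lra.
Import Order.TTheory GRing.Theory Num.Theory.
Import numFieldNormedType.Exports.
Local Open Scope classical_set_scope.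
Local Open Scope ring_scope.

Set Implicit Arguments.
Unset Strict Implicit.
Unset Printing Implicit Defensive.

(** Write [F z] for [phi z + psi (L z)], [m] for its minimum and [D] for the
    Bregman distance of [f]. The optimality condition of the proximal step,
    the three-point identity for [D] and the inequality
    [gamma n * D_psi (L u) (L v) <= D u v] combine into the descent estimate
    [gamma n * (F (x (n+1)) - F z) + D z (x (n+1)) <= D z (x n)], valid for
    every [z] at which all the functions are finite
    ([forward_backward_step]). Taking for [z] a solution in the interior of
    the domain of [f] shows that [F (x n)] tends to [m], that [D z (x n)]
    decreases, and, by coercivity, that the sequence is bounded.

    In a reflexive space a bounded sequence converges weakly along every
    ultrafilter ([weak_lim_exists]). As [F] is convex and lower semicontinuous,
    each such limit is a solution; [xbar] is one of them, chosen once and for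
    all. Weak convergence of the sequence means that all these limits agree.
    If two of them, [z1] and [z2], are interior to the domain of [f], then
    [D z1 (x n) - D z2 (x n)] converges, so [grad f (x n) (z1 - z2)] converges;
    when [grad f] is weakly sequentially continuous the limit is both
    [grad f z1 (z1 - z2)] and [grad f z2 (z1 - z2)], and strict convexity gives
    [z1 = z2] ([weak_cluster_points_equal]). Continuity along sequences is used
    here, so a subsequence has to be extracted from the ultrafilter
    ([eberlein_smulian]). When the conjugate of [f] has an open domain and a
    weakly sequentially continuous gradient, the weak limits are values of that
    gradient and thereby interior ([weak_cluster_point_interior]).

    For strong convergence under uniform convexity, compare [F] at the midpoint
    of [xbar] and [x n] with [m]: the modulus at [|xbar - x n|] is at most a
    multiple of [F (x n) - m] ([uniformly_convex_at_cvg]). If instead the Bregman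
    distance to the solution set has lower limit zero, some solution [z] is
    [D]-close to some [x N], hence to all later iterates since [D z (x n)]
    decreases; the sequential condition on [f] turns this into closeness in
    norm ([bregman_small_dist]), and the sequence is Cauchy.

    The functional analysis rests on one separation result, [sandwich]: an
    affine function fits between a convex function and a concave one below it
    as soon as the former is bounded near a point where the latter is finite.
    It yields separation of points from closed convex sets, norming
    functionals, the sum rule for subdifferentials ([fermat_sum]), the
    equality of the domain of the subdifferential of [f] with the interior of
    the domain ([dom_subdiff_interior]), Gateaux differentiability from
    uniqueness of the subgradient ([unique_subgradient_gateaux]) and a
    Fenchel-Moreau property ([subdiff_of_conjugate]). *)

(** * The Hahn-Banach theorem *)

Section Sublinear.
Context {R : realType} {V : lmodType R}.
Implicit Types (p q : V -> R) (x y : V).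

Definition sublinear p :=
  (forall x y, p (x + y) <= p x + p y) /\
  (forall t x, 0 < t -> p (t *: x) <= t * p x).

Lemma sublinearZ p t x : sublinear p -> 0 < t -> p (t *: x) = t * p x.
Proof.
move=> [_ pZ] t0; apply/eqP; rewrite eq_le pZ//=.
rewrite -ler_pdivlMl//; have := pZ t^-1 (t *: x).
by rewrite scalerA mulVf ?gt_eqF// scale1r invr_gt0; apply.
Qed.

Lemma sublinear0 p : sublinear p -> p 0 = 0.
Proof.
move=> /(@sublinearZ _ 2 0); rewrite scaler0 ltr0n => /(_ isT) p0.
by apply/eqP; lra.
Qed.

Lemma sublinearN p x : sublinear p -> - p (- x) <= p x.
Proof.
move=> sp; have [pD _] := sp; have := pD x (- x).
by rewrite subrr (sublinear0 sp); lra.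
Qed.

Lemma le_infD (A B : set R) c : A !=set0 -> B !=set0 ->
  (forall a b, A a -> B b -> c <= a + b) -> c <= inf A + inf B.
Proof.
move=> A0 B0 cAB; rewrite -lerBlDl; apply: lb_le_inf => // b Bb.
rewrite lerBlDl -lerBlDr; apply: lb_le_inf => // a Aa.
by rewrite lerBlDr; exact: cAB.
Qed.

(** A chain of sublinear minorants of [p] cannot escape to -oo, because each
    of them is at least [- p (- x)] at [x]; its pointwise infimum is then
    sublinear, so that Zorn's lemma applies. *)
Lemma minimal_sublinear p : sublinear p -> exists q,
  [/\ sublinear q, forall x, q x <= p x &
      forall q', sublinear q' -> (forall x, q' x <= q x) ->
        forall x, q x <= q' x].
Proof.
move=> sp.
pose T := {q : V -> R | sublinear q /\ forall x, q x <= p x}.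
pose r (q1 q2 : T) := `[< forall x, sval q2 x <= sval q1 x >].
have [||| [q [sq qp]] qmax] := @ZL_preorder T
  (exist _ p (conj sp (fun x => lexx (p x)))) r.
- by move=> q; apply/asboolP.
- move=> q2 q1 q3 /asboolP q12 /asboolP q23; apply/asboolP => x.
  exact: le_trans (q23 x) (q12 x).
- move=> A Atot; have [[q0 Aq0]|A0] := pselect (A !=set0); last first.
    exists (exist _ p (conj sp (fun x => lexx (p x)))) => q Aq.
    by case: A0; exists q.
  pose E x := [set sval q x | q in A].
  have E0 x : E x !=set0 by exists (sval q0 x), q0.
  have Elb x : has_lbound (E x).
    exists (- p (- x)) => _ [[q [sq qp]] _ <-] /=.
    by apply: le_trans (sublinearN x sq); rewrite lerN2.
  have Ele x (q : T) : A q -> inf (E x) <= sval q x.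
    by move=> Aq; apply: ge_inf => //; exists q.
  have sE : sublinear (fun x => inf (E x)).
    split=> [x y|t x t0].
      apply: le_infD => // _ _ [q1 Aq1 <-] [q2 Aq2 <-].
      have [/asboolP q12|/asboolP q21] := Atot _ _ Aq1 Aq2.
        apply: (le_trans (Ele _ _ Aq2)).
        have [[qD _] _] := svalP q2.
        by apply: (le_trans (qD x y)); rewrite lerD2r.
      apply: (le_trans (Ele _ _ Aq1)).
      have [[qD _] _] := svalP q1.
      by apply: (le_trans (qD x y)); rewrite lerD2l.
    rewrite -ler_pdivrMl//; apply: lb_le_inf => // _ [q Aq <-].
    rewrite ler_pdivrMl//; apply: (le_trans (Ele _ _ Aq)).
    by have [[_ qZ] _] := svalP q; exact: qZ.
  have Ep x : inf (E x) <= p x.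
    by apply: (le_trans (Ele _ _ Aq0)); have [_] := svalP q0; apply.
  exists (exist _ (fun x => inf (E x)) (conj sE Ep)) => q Aq.
  by apply/asboolP => x; exact: Ele.
exists q; split=> // q' sq' q'q.
have q'p x : q' x <= p x by exact: le_trans (q'q x) (qp x).
have /= := qmax (exist _ q' (conj sq' q'p)).
by move=> /(_ (asboolT q'q)) /asboolP.
Qed.

(** Lowering [q] along a direction [a] gives the sublinear function
    [x |-> inf_(t >= 0) (q (x + t a) - t q a)]; if [q] is minimal nothing is
    lost, and [t = 1] shows that [q] is superadditive. *)
Lemma minimal_sublinear_linear q : sublinear q ->
  (forall q', sublinear q' -> (forall x, q' x <= q x) ->
    forall x, q x <= q' x) ->
  forall x y, q (x + y) = q x + q y.
Proof.
move=> sq qmin x a; have [qD qZ] := sq; apply/eqP; rewrite eq_le qD/=.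
pose E x := [set q (x + t *: a) - t * q a | t in [set t | 0 <= t]].
have E0 y : E y !=set0 by eexists; exists 0 => //=.
have Elb y : has_lbound (E y).
  exists (- q (- y)) => _ [t /= t0 <-].
  have := qD (y + t *: a) (- y); rewrite addrAC subrr add0r.
  have [<-|t1] := eqVneq 0 t.
    by rewrite scale0r (sublinear0 sq); lra.
  by rewrite sublinearZ ?lt_neqAle ?t1//; lra.
have Ele y t : 0 <= t -> inf (E y) <= q (y + t *: a) - t * q a.
  by move=> t0; apply: ge_inf => //; exists t.
have sE : sublinear (fun y => inf (E y)).
  split=> [y z|t y t0].
    apply: le_infD => // _ _ [s s0 <-] [t t0 <-].
    apply: (le_trans (Ele _ (s + t) _)); first exact: addr_ge0.
    have := qD (y + s *: a) (z + t *: a).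
    by rewrite addrACA -scalerDl; lra.
  rewrite -ler_pdivrMl//; apply: lb_le_inf => // _ [s /= s0 <-].
  rewrite ler_pdivrMl//; apply: (le_trans (Ele _ (t * s) _)).
    by rewrite mulr_ge0// ltW.
  by rewrite -scalerA -scalerDr sublinearZ// -mulrA mulrBr.
have Eq y : inf (E y) <= q y.
  by apply: (le_trans (Ele y 0 _)) => //; rewrite scale0r mul0r addr0 subr0.
have := Ele x 1 ler01; rewrite scale1r mul1r; have := qmin _ sE Eq x.
by move: (inf _) => m; lra.
Qed.

(** A minimal sublinear function is linear, so no partially defined functional
    ever has to be extended. *)
Theorem hahn_banach p : sublinear p ->
  exists l : V -> R, (linear (l : V -> R^o)) /\ forall x, l x <= p x.
Proof.
move=> /minimal_sublinear[q [sq qp qmin]]; exists q; split=> // a x y.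
have qD := minimal_sublinear_linear sq qmin.
have q0 := sublinear0 sq.
have qN z : q (- z) = - q z.
  by apply/eqP; rewrite -addr_eq0 -qD addNr q0.
rewrite qD; congr (_ + _).
have [a0|a0|->] := ltgtP a 0; last 2 first.
- by rewrite sublinearZ.
- by rewrite !scale0r q0.
- have := sublinearZ (t := - a) x sq; rewrite oppr_gt0 a0 => /(_ isT).
  by rewrite scaleNr qN mulNr => /oppr_inj.
Qed.

End Sublinear.

(** * The sandwich theorem *)

Section Functionals.
Context {R : realType} {X : normedModType R}.

(** An upper bound on the unit ball is a bound on the absolute value, the ball
    being symmetric. *)
Lemma functional_of_linear (l : X -> R) (C : R) : linear (l : X -> R^o) ->
  (forall x, `|x| <= 1 -> l x <= C) -> exists xs : dual X, forall x, xs x = l x.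
Proof.
move=> ll lC.
pose l' : {linear X -> R^o} :=
  HB.pack (l : X -> R^o) (GRing.isLinear.Build _ _ _ _ _ ll).
have cl : continuous (l : X -> R^o).
  apply: (@bounded_linear_continuous R X R^o l').
  apply/ex_bound; exists C; apply/nbhs_normP => /=; exists 1 => //= x /=.
  rewrite sub0r normrN => /ltW x1.
  rewrite ler_norml lC// andbT lerNl.
  by rewrite -(linearN l' x) lC// normrN.
have ml : (l : X -> R^o) \in @bounded_linear R X R^o by apply/asboolP.
by exists (BoundedOperator ml).
Qed.

Lemma dualB (xs : dual X) x y : xs (x - y) = xs x - xs y.
Proof. exact: linearB. Qed.
Lemma dualD (xs : dual X) x y : xs (x + y) = xs x + xs y.
Proof. exact: linearD. Qed.
Lemma dualN (xs : dual X) x : xs (- x) = - xs x.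
Proof. exact: linearN. Qed.
Lemma dual0 (xs : dual X) : xs 0 = 0.
Proof. exact: linear0. Qed.
Lemma dualZ (xs : dual X) t x : xs (t *: x) = t * xs x.
Proof. exact: linearZ. Qed.

Definition convex_rel (P : X -> R -> Prop) := forall x y r s t,
  0 < t < 1 -> P x r -> P y s ->
  P (t *: x + (1 - t) *: y) (t * r + (1 - t) * s).

(** [P] and [Q] play the role of the epigraphs of two convex functions with
    nonnegative sum; relations rather than functions avoid extended real values
    and make indicator functions of points, segments and convex sets
    convenient. The slopes [(r + s) / t], for [P w r], [Q y s] and
    [w - y = t x], form a set whose infimum is a sublinear function of [x]: it
    is finite everywhere because [P] holds on a ball about [z], and bounded
    below because the slopes at [x] and [- x] have nonnegative sum. A linear
    minorant of it is the slope sought. *)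
Theorem sandwich (P Q : X -> R -> Prop) (z : X) (s0 M d : R) :
  convex_rel P -> convex_rel Q ->
  (forall x r s, P x r -> Q x s -> 0 <= r + s) ->
  Q z s0 -> 0 < d -> (forall x, `|x - z| < d -> P x M) ->
  exists (xs : dual X) (c : R), (forall x r, P x r -> xs x + c <= r) /\
    (forall x s, Q x s -> - s <= xs x + c).
Proof.
move=> cP cQ PQ Qz d0 Pz.
pose E (x : X) := [set k : R | exists (t : R) (w : X) (r : R) (y : X) (s : R),
  [/\ 0 < t, P w r, Q y s, w - y = t *: x & r + s = t * k]].
(* a step small enough for [z + tau x *: x] to stay in the ball about [z] *)
pose tau (x : X) := d / (`|x| + 2).
have x20 (x : X) : 0 < `|x| + 2 :> R by rewrite ltr_wpDl.
have tau0 x : 0 < tau x by rewrite divr_gt0// x20.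
have Etau x : E x ((M + s0) / tau x).
  exists (tau x), (z + tau x *: x), M, z, s0; split=> //.
  - apply: Pz; rewrite addrAC subrr add0r normrZ gtr0_norm//.
    by rewrite /tau mulrAC ltr_pdivrMr ?x20// ltr_pM2l// ltrDl.
  - by rewrite addrAC subrr add0r.
  - by rewrite mulrC divfK// gt_eqF.
have ED x y h k : E x h -> E y k -> E (x + y) (h + k).
  move=> [t1 [w1 [r1 [y1 [s1 [t10 Pw1 Qy1 xE hE]]]]]].
  move=> [t2 [w2 [r2 [y2 [s2 [t20 Pw2 Qy2 yE kE]]]]]].
  have t0 : 0 < t1 + t2 by rewrite addr_gt0.
  pose a := t2 / (t1 + t2).
  have aE : 1 - a = t1 / (t1 + t2).
    by rewrite /a; field; rewrite gt_eqF.
  have a01 : 0 < a < 1.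
    by rewrite -(subr_gt0 a) aE !divr_gt0.
  exists (t1 * t2 / (t1 + t2)), (a *: w1 + (1 - a) *: w2),
    (a * r1 + (1 - a) * r2), (a *: y1 + (1 - a) *: y2),
    (a * s1 + (1 - a) * s2); split.
  - by rewrite divr_gt0// mulr_gt0.
  - exact: cP.
  - exact: cQ.
  - rewrite opprD addrACA -!scalerBr xE yE aE !scalerA scalerDr.
    by congr (_ *: _ + _ *: _); rewrite /a; field; rewrite gt_eqF.
  - rewrite addrACA -!mulrDr hE kE aE !mulrA mulrDr.
    by congr (_ * _ + _ * _); rewrite /a; field; rewrite gt_eqF.
have EZ t x k : 0 < t -> E x k -> E (t *: x) (t * k).
  move=> t0 [t1 [w1 [r1 [y1 [s1 [t10 Pw1 Qy1 xE hE]]]]]].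
  exists (t1 / t), w1, r1, y1, s1; split=> //.
  - by rewrite divr_gt0.
  - by rewrite scalerA divfK ?gt_eqF.
  - by rewrite mulrA divfK ?gt_eqF.
have E0 k : E 0 k -> 0 <= k.
  move=> [t1 [w1 [r1 [y1 [s1 [t10 Pw1 + + hE]]]]]].
  move=> /[swap]; rewrite scaler0 => /eqP; rewrite subr_eq0 => /eqP <- Qw1.
  by rewrite -(pmulr_rge0 _ t10) -hE; exact: PQ Qw1.
have En0 x : E x !=set0 by eexists; exact: Etau.
have Elb x : has_lbound (E x).
  have [k Ek] := En0 (- x); exists (- k) => h Eh.
  by rewrite -subr_ge0 opprK; apply: E0; rewrite -(subrr x); exact: ED.
have Ele x k : E x k -> inf (E x) <= k by move=> Ek; exact: ge_inf.
have [|l [ll lE]] := @hahn_banach R X (fun x => inf (E x)).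
  split=> [x y|t x t0].
    by apply: le_infD => // h k Eh Ek; apply: Ele; exact: ED.
  rewrite -ler_pdivrMl//; apply: lb_le_inf => // k Ek.
  by rewrite ler_pdivrMl//; apply: Ele; exact: EZ.
have lk x k : E x k -> l x <= k by move=> /Ele; exact: le_trans.
have [|xs xsl] := @functional_of_linear l (`|M + s0| * (3 / d)) ll.
  move=> x x1; apply: (le_trans (lk _ _ (Etau x))).
  apply: (le_trans (ler_norm _)); rewrite normrM ler_wpM2l//.
  rewrite gtr0_norm ?invr_gt0// /tau invf_div ler_pM2r ?invr_gt0//.
  by move: x1; lra.
have PQl x r y s : P x r -> Q y s -> xs x - r <= xs y + s.
  move=> Pxr Qys; have : l (x - y) <= r + s.
    by apply: lk; exists 1, x, r, y, s; rewrite ltr01 scale1r mul1r.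
  by rewrite -xsl dualB; lra.
pose A := [set xs v.1 - v.2 | v in [set v : X * R | P v.1 v.2]].
exists xs, (- sup A); split=> [x r Pxr|y s Qys].
  suff : xs x - r <= sup A by lra.
  apply: ub_le_sup; last by exists (x, r).
  by exists (xs z + s0) => _ [[w q] /= Pwq <-]; exact: PQl.
suff : sup A <= xs y + s by lra.
apply: ge_sup.
  exists (xs z - M), (z, M) => //=; apply: Pz.
  by rewrite subrr normr0.
by move=> _ [[w q] /= Pwq <-]; exact: PQl.
Qed.

End Functionals.

(** * Weak limits along ultrafilters *)

Section Ultrafilters.
Context {R : realType}.

Lemma ultra_bounded_cvg (U : set_system nat) (a : nat -> R) (M : R) :
  UltraFilter U -> (forall n, `|a n| <= M) -> exists l : R, a @ U --> l.
Proof.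
move=> UU aM.
have [|l [_ cl]] := @segment_compact R (- M) M (a @ U) _.
  have : U (fun n => `[- M, M]%classic (a n)).
    by apply: filterE => n; rewrite /= in_itv/= -ler_norml.
  by [].
exists l => V lV; have [//|UnV] := in_ultra_setVsetC (a @^-1` V) UU.
by have [r []] := cl (~` V) V UnV lV.
Qed.

(** If [a] failed to converge, it would stay outside some neighbourhood of [l]
    along an ultrafilter. *)
Lemma cvg_of_ultra (T : topologicalType) (a : nat -> T) (l : T) :
  (forall U : set_system nat, UltraFilter U -> \oo `<=` U -> a @ U --> l) ->
  a @ \oo --> l.
Proof.
move=> aU V lV; apply: contrapT => nV.
pose G := within (a @^-1` (~` V)) (\oo : set_system nat).
have GF : ProperFilter G.
  apply: Build_ProperFilter_ex => B GB; apply: contrapT => B0; apply: nV.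
  have {}GB : \forall n \near \oo, ~ V (a n) -> B n by [].
  have : \forall n \near \oo, V (a n); last by [].
  apply: filterS GB => n /= nB; apply: contrapT => nVn.
  by apply: B0; exists n; exact: nB.
have [U [UU GU]] := ultraFilterLemma GF.
have UV : U (a @^-1` V).
  apply: aU => //; apply: subset_trans GU; exact: cvg_within.
have : U (a @^-1` (~` V)) by apply: GU; exact: withinT.
by move=> /(filterI UV)/filter_ex[n []].
Qed.

End Ultrafilters.

Section WeakLimits.
Context {R : realType} {X : normedModType R}.

(** Along an ultrafilter a bounded sequence has a weak limit without passing to
    a subsequence; [weakly_cvg] is the case [U = \oo]. *)
Definition weak_lim (U : set_system nat) (u : nat -> X) (x : X) :=
  forall xs : dual X, (fun n => xs (u n)) @ U --> xs x.

Lemma le_dual_norm (xs : dual X) x : `|xs x| <= `|xs| * `|x|.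
Proof.
have [->|x0] := eqVneq x 0; first by rewrite dual0 !normr0 mulr0.
have nx : 0 < `|x| by rewrite normr_gt0.
rewrite -ler_pdivrMr//.
have := @operator_norm_ub R X R^o xs (`|x|^-1 *: x).
rewrite normrZ normfV normr_id mulVf ?gt_eqF// => /(_ (lexx _)).
by rewrite dualZ normrM normfV normr_id mulrC.
Qed.

Lemma dual_normW (xs : dual X) C : (forall x, `|x| <= 1 -> xs x <= C) ->
  `|xs| <= C.
Proof.
move=> xC; apply: operator_norm_le => x x1.
by rewrite ler_norml xC// andbT lerNl -dualN xC// normrN.
Qed.

Definition convex_subset (C : set X) := forall x y (t : R), 0 < t < 1 ->
  C x -> C y -> C (t *: x + (1 - t) *: y).

Lemma norm_convex (x y a : X) (t : R) : 0 < t < 1 ->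
  `|t *: x + (1 - t) *: y - a| <= t * `|x - a| + (1 - t) * `|y - a|.
Proof.
move=> /andP[t0 t1].
have -> : t *: x + (1 - t) *: y - a = t *: (x - a) + (1 - t) *: (y - a).
  rewrite !scalerBr addrACA -opprD -scalerDl.
  by rewrite (_ : t + (1 - t) = 1) ?scale1r//; ring.
rewrite (le_trans (ler_normD _ _))// !normrZ gtr0_norm// gtr0_norm//.
by rewrite subr_gt0.
Qed.

(** Sandwich theorem for [|w - y| - d], with [d] the radius of a ball about [y]
    disjoint from [C], and the indicator function of [C]. *)
Lemma separation (C : set X) y : closed C -> convex_subset C -> ~ C y ->
  exists (xs : dual X) (c : R), (forall x, C x -> c <= xs x) /\ xs y < c.
Proof.
move=> Ccl Ccv nCy.
have [[z Cz]|C0] := pselect (C !=set0); last first.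
  exists 0, 1; split=> [x Cx|]; first by case: C0; exists x.
  exact: ltr01.
have : nbhs y (~` C) by apply: open_nbhs_nbhs; split => //; exact/closed_openC.
move=> /nbhs_ballP[d /= d0 dC].
have [||||||xs [c [xsP xsQ]]] := @sandwich R X
  (fun w r => `|w - y| - d <= r) (fun w s => C w /\ 0 <= s)
  z 0 (`|z - y| + 1) 1.
- move=> w w' r r' t t01 wr wr'; have := norm_convex w w' y t01.
  case/andP: t01 => t0 t1.
  have := ler_wpM2l (ltW t0) wr.
  have : 0 <= 1 - t by lra.
  by move=> /ler_wpM2l/(_ _ _ wr'); lra.
- move=> w w' r r' t t01 [Cw r0] [Cw' r0']; split; first exact: Ccv.
  by case/andP: t01 => t0 t1; rewrite addr_ge0// mulr_ge0 ?subr_ge0// ltW.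
- move=> w r s wr [Cw s0]; rewrite addr_ge0//; apply: le_trans wr.
  rewrite subr_ge0 leNgt; apply/negP => wy.
  by apply: (dC w) => //; rewrite -ball_normE /= distrC.
- by split.
- exact: ltr01.
- move=> w wz; have := ler_distD z w y; lra.
exists xs, (- c); split=> [x Cx|].
  by have := xsQ x 0; rewrite oppr0 => /(_ (conj Cx (lexx _))); lra.
have := xsP y (- d); rewrite subrr normr0 sub0r => /(_ (lexx _)); lra.
Qed.

Lemma weak_lim_closed_convex (U : set_system nat) {FU : ProperFilter U} u x
    (C : set X) : closed C -> convex_subset C ->
  (\forall n \near U, C (u n)) -> weak_lim U u x -> C x.
Proof.
move=> Ccl Ccv UC ux; apply: contrapT => nCx.
have [xs [c [xsC xsx]]] := separation Ccl Ccv nCx.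
have : c <= xs x.
  by apply: (cvgr_to_ge (ux xs)); apply: filterS UC => n; exact: xsC.
by rewrite leNgt xsx.
Qed.

(** Sandwich theorem for the norm and the function equal to [- `|d|] at [d] and
    to +oo elsewhere; homogeneity of the norm removes the constant term. *)
Lemma norming_functional (d : X) : exists xs : dual X,
  (forall x, xs x <= `|x|) /\ xs d = `|d|.
Proof.
have [||||||xs [c [xsP xsQ]]] := @sandwich R X
  (fun w r => `|w| <= r) (fun w s => w = d /\ - `|d| <= s)
  d (- `|d|) (`|d| + 1) 1.
- move=> w w' r r' t t01 wr wr'; have := norm_convex w w' 0 t01.
  rewrite !subr0; case/andP: t01 => t0 t1.
  have := ler_wpM2l (ltW t0) wr.
  have : 0 <= 1 - t by lra.
  by move=> /ler_wpM2l/(_ _ _ wr'); lra.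
- move=> w w' r r' t /andP[t0 t1] [-> r0] [-> r0']; split.
    by rewrite -scalerDl (_ : t + (1 - t) = 1) ?scale1r//; ring.
  have := ler_wpM2l (ltW t0) r0.
  have : 0 <= 1 - t by lra.
  by move=> /ler_wpM2l/(_ _ _ r0'); lra.
- by move=> w r s wr [wd ds]; move: wr; rewrite wd; lra.
- by split.
- exact: ltr01.
- move=> w wz; have := ler_normD (w - d) d; rewrite subrK; lra.
have c0 : c <= 0 by have := xsP 0 0; rewrite normr0 dual0 add0r; apply.
have xs1 x : xs x <= `|x|.
  rewrite leNgt; apply/negP => xlt.
  have s0 : 0 < xs x - `|x| by rewrite subr_gt0.
  pose t := (1 - c) / (xs x - `|x|).
  have t0 : 0 < t by rewrite divr_gt0//; lra.
  have := xsP (t *: x) (t * `|x|).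
  rewrite normrZ (gtr0_norm t0) lexx => /(_ isT).
  rewrite dualZ.
  suff : t * xs x - t * `|x| = 1 - c by lra.
  by rewrite -mulrBr divfK ?gt_eqF.
exists xs; split => //; apply/eqP; rewrite eq_le xs1/=.
have := xsQ d (- `|d|); rewrite opprK => /(_ (conj erefl (lexx _))); lra.
Qed.

(** The limits of the [xs (u n)] depend linearly and boundedly on [xs], hence
    form an element of the bidual, which is a point of [X]. *)
Lemma weak_lim_exists (U : set_system nat) (u : nat -> X) (M : R) :
  reflexive_space X -> UltraFilter U -> (forall n, `|u n| <= M) ->
  exists x, weak_lim U u x.
Proof.
move=> reflX UU uM.
have bd (xs : dual X) n : `|xs (u n)| <= `|xs| * M.
  by apply: (le_trans (le_dual_norm _ _)); rewrite ler_wpM2l.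
have /choice[l xsl] (xs : dual X) :
    exists l : R, (fun n => xs (u n)) @ U --> (l : R).
  exact: ultra_bounded_cvg (bd xs).
have ll : linear (l : dual X -> R^o).
  move=> a xs ys.
  have lD : (fun n => a * xs (u n) + ys (u n)) @ U --> (a * l xs + l ys : R).
    by apply: cvgD; [apply: cvgMl_tmp; exact: xsl|exact: xsl].
  exact: (cvg_unique _ (xsl (a *: xs + ys)) lD).
have [|xss xssl] := @functional_of_linear R (dual X) l M ll.
  move=> xs xs1; apply: (cvgr_to_le (xsl xs)); apply: filterE => n /=.
  apply: (le_trans (ler_norm _)); apply: (le_trans (bd _ _)).
  by rewrite ler_piMl// (le_trans _ (uM 0%N)).
have [x xE] := reflX xss; exists x => xs.
by rewrite -xE xssl; exact: xsl.
Qed.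

End WeakLimits.

(** * Weak sequential compactness *)

Section EberleinSmulian.
Context {R : realType} {X : normedModType R}.

Lemma closure_normP (D : set X) a :
  closure D a <-> forall e : R, 0 < e -> exists2 b, D b & `|a - b| < e.
Proof.
split=> [clD e e0|clD B /nbhs_ballP[e /= e0 eB]].
  have [b [Db ab]] := clD _ (nbhsx_ballx a e e0).
  by exists b => //; move: ab; rewrite -ball_normE.
have [b Db ab] := clD _ e0; exists b; split => //.
by apply: eB; rewrite -ball_normE.
Qed.

Definition rat_comb (v : nat -> X) (s : seq rat) : X :=
  \sum_(i < size s) (ratr s`_i : R) *: v i.

Lemma rat_combE v s n : (size s <= n)%N ->
  rat_comb v s = \sum_(i < n) (ratr s`_i : R) *: v i.
Proof.
move=> sn; rewrite /rat_comb.
rewrite (big_ord_widen n (fun i => (ratr s`_i : R) *: v i) sn) big_mkcond/=.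
apply: eq_bigr => i _; case: ltnP => // si.
by rewrite nth_default// rmorph0 scale0r.
Qed.

Lemma rat_combD v s1 s2 : exists s, rat_comb v s1 + rat_comb v s2 = rat_comb v s.
Proof.
pose n := maxn (size s1) (size s2).
exists (mkseq (fun i => s1`_i + s2`_i) n).
rewrite (@rat_combE v s1 n) ?leq_maxl// (@rat_combE v s2 n) ?leq_maxr//.
rewrite (@rat_combE v _ n) ?size_mkseq// -big_split/=; apply: eq_bigr => i _.
by rewrite nth_mkseq// rmorphD scalerDl.
Qed.

Lemma rat_combZ v (q : rat) s : exists s', (ratr q : R) *: rat_comb v s = rat_comb v s'.
Proof.
exists (map (fun r => q * r) s).
rewrite /rat_comb scaler_sumr size_map; apply: eq_bigr => i _.
by rewrite (nth_map 0)// rmorphM scalerA.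
Qed.

Lemma rat_comb_base v i : exists s, v i = rat_comb v s.
Proof.
exists (rcons (nseq i 0) 1).
rewrite /rat_comb size_rcons size_nseq big_ord_recr/= big1 ?add0r.
  by rewrite nth_rcons size_nseq ltnn eqxx rmorph1 scale1r.
move=> j _; rewrite nth_rcons size_nseq ltn_ord nth_nseq ltn_ord.
by rewrite rmorph0 scale0r.
Qed.

Section RationalSpan.
Variable v : nat -> X.
Local Notation D := (range (rat_comb v)).

Lemma rat_spanD a b : closure D a -> closure D b -> closure D (a + b).
Proof.
move=> /closure_normP Da /closure_normP Db; apply/closure_normP => e e0.
have e20 : 0 < e / 2 by rewrite divr_gt0.
have [_ [s _ <-] sa] := Da _ e20; have [_ [t _ <-] tb] := Db _ e20.
have [r rE] := rat_combD v s t; exists (rat_comb v r); first by exists r.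
rewrite -rE opprD addrACA (le_lt_trans (ler_normD _ _))//.
by move: sa tb; lra.
Qed.

Lemma rat_spanZ (t : R) a : closure D a -> closure D (t *: a).
Proof.
move=> /closure_normP Da; apply/closure_normP => e e0.
have t20 : 0 < 2 * (`|t| + 1) by rewrite mulr_gt0// ltr_wpDl.
have [_ [s _ <-] sa] := Da (e / (2 * (`|t| + 1))) (divr_gt0 e0 t20).
set d := rat_comb v s in sa *.
have d20 : 0 < 2 * (`|d| + 1) by rewrite mulr_gt0// ltr_wpDl.
have [q] : exists q : rat, t < ratr q < t + e / (2 * (`|d| + 1)).
  have [q] := @rat_in_itvoo R t (t + e / (2 * (`|d| + 1)))
     (ltr_pwDr (divr_gt0 e0 d20) (lexx t)).
  by rewrite in_itv/= => qq; exists q.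
move=> /andP[tq qt].
have [r rE] := rat_combZ v q s; exists (rat_comb v r); first by exists r.
rewrite -rE -/d.
have -> : t *: a - ratr q *: d = t *: (a - d) + (t - ratr q) *: d.
  by rewrite scalerBr scalerBl addrA subrK.
rewrite (le_lt_trans (ler_normD _ _))// !normrZ.
have h1 : `|t| * `|a - d| <= `|t| * (e / (2 * (`|t| + 1))).
  by rewrite ler_wpM2l// ltW.
have h2 : `|t - ratr q| * `|d| <= (e / (2 * (`|d| + 1))) * `|d|.
  by rewrite ler_wpM2r// ler0_norm; lra.
have half (y : R) : 0 <= y -> y * (e / (2 * (y + 1))) < e / 2.
  move=> y0; have y1 : 0 < y + 1 by lra.
  rewrite mulrA ltr_pdivrMr; last by rewrite mulr_gt0.
  by rewrite mulrA divfK ?pnatr_eq0//; nra.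
have := half _ (normr_ge0 t); have := half _ (normr_ge0 d).
by rewrite [`|d| * _]mulrC; lra.
Qed.

Lemma rat_span_base i : closure D (v i).
Proof. by apply: subset_closure; have [s ->] := rat_comb_base v i; exists s. Qed.

End RationalSpan.

(** The rational combinations of [x] and the [u n] are countable and dense in a
    closed convex set containing every weak limit point of [u]; a norming
    functional for each of them gives a sequence of functionals separating the
    points of that set. A diagonal choice makes [u \o k] converge to [x] along
    these functionals, so every weak limit of [u \o k] along an ultrafilter
    is [x]. *)
Theorem eberlein_smulian (U : set_system nat) (u : nat -> X) (M : R) x :
  reflexive_space X -> UltraFilter U -> \oo `<=` U ->
  (forall n, `|u n| <= M) -> weak_lim U u x ->
  exists k : nat -> nat, (forall n, (n <= k n)%N) /\ weakly_cvg (u \o k) x.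
Proof.
move=> reflX UU ooU uM ux.
(* [x] is listed too, so that [y - x] below is a limit of combinations *)
pose v i := if i is j.+1 then u j else x.
pose D := range (rat_comb v).
have /choice[g gP] (s : seq rat) := norming_functional (rat_comb v s).
pose h n := g (odflt [::] (unpickle n)).
have kP n : exists m, (n <= m)%N /\ forall j, (j <= n)%N ->
    `|h j (u m) - h j x| < n.+1%:R^-1.
  have e0 : (0 : R) < n.+1%:R^-1 by rewrite invr_gt0.
  have : \forall m \near U, (n <= m)%N /\
      forall j : 'I_n.+1, `|h j (u m) - h j x| < n.+1%:R^-1.
    apply: filterI; first by apply: ooU; exact: nbhs_infty_ge.
    apply: filter_forall => j.
    have /cvgr_dist_lt/(_ _ e0) := ux (h j).
    by apply: filterS => m; rewrite distrC.
  move=> /filter_ex[m [nm hm]]; exists m; split=> // j jn.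
  exact: hm (Ordinal (jn : (j < n.+1)%N)).
have /choice[k {}kP] := kP; exists k; split=> [n|xs]; first by have [] := kP n.
apply: (@cvg_of_ultra R^o) => V VV ooV.
have [y uy] : exists y, weak_lim V (u \o k) y.
  by apply: (weak_lim_exists (M := M)) => // n; exact: uM.
suff -> : x = y by exact: uy.
have clD : closed (closure D) by exact: closed_closure.
have cvD : convex_subset (closure D).
  by move=> a b t _ Da Db; apply: rat_spanD; exact: rat_spanZ.
have Dy : closure D y.
  apply: (weak_lim_closed_convex clD cvD _ uy).
  apply: filterE => n. rewrite (_ : (u \o k) n = v (k n).+1)//; exact: rat_span_base.
have Dyx : closure D (y - x).
  apply: rat_spanD => //; rewrite -scaleN1r; apply: rat_spanZ.
  rewrite (_ : x = v 0%N)//; exact: rat_span_base.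
have hyx j : h j y = h j x.
  apply: (@cvg_unique _ (@Rhausdorff R) _ _ _ _ (uy (h j))).
  apply: (cvg_trans _ (_ : h j ((u \o k) n) @[n --> \oo] --> h j x)).
    exact: cvg_fmap2.
  apply/cvgrPdist_lt => e e0.
  near=> n; have [_ /(_ j)] := kP n.
  rewrite /= distrC => /(_ _)/lt_trans; apply; first by near: n; exact: nbhs_infty_ge.
  by near: n; exact: near_infty_natSinv_lt (PosNum e0).
apply/eqP; rewrite eq_sym -subr_eq0 -normr_le0; apply/ler_addgt0Pl => e e0.
rewrite addr0.
have [_ [s _ <-] sa] := (closure_normP _ _).1 Dyx _ (divr_gt0 e0 (ltr0Sn _ 1)).
have [g1 gs] := gP s.
have : g s (y - x) = 0.
  have := hyx (pickle s); rewrite /h pickleK /= => gE.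
  by rewrite dualB gE subrr.
have := g1 (rat_comb v s - (y - x)); rewrite dualB gs distrC.
have := ler_normD (y - x - rat_comb v s) (rat_comb v s); rewrite subrK.
by move: sa; lra.
Unshelve. all: by end_near. Qed.

End EberleinSmulian.

(** * Interiors of convex sets *)

Section Interior.
Context {R : realType} {X : normedModType R}.

Lemma interior_normP (D : set X) x :
  D° x <-> exists2 d : R, 0 < d & forall y, `|y - x| < d -> D y.
Proof.
split=> [/nbhs_ballP[d /= d0 dD]|[d d0 dD]].
  by exists d => // y yx; apply: dD; rewrite -ball_normE /= distrC.
apply/nbhs_ballP; exists d => // y; rewrite -ball_normE /= distrC; exact: dD.
Qed.

(** A point [y] near the given one is [t *: x + (1 - t) *: w] with [w]
    near [z]. *)
Lemma interior_open_segment (C : set X) x z (t : R) : convex_subset C ->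
  C x -> C° z -> 0 < t < 1 -> C° (t *: x + (1 - t) *: z).
Proof.
move=> cC Cx /interior_normP[d d0 dC] t01; have /andP[t0 t1] := t01.
have s0 : 0 < 1 - t by rewrite subr_gt0.
apply/interior_normP; exists ((1 - t) * d); first by rewrite mulr_gt0.
move=> y yd.
pose w := (1 - t)^-1 *: (y - t *: x).
have -> : y = t *: x + (1 - t) *: w.
  by rewrite /w scalerA divff ?gt_eqF// scale1r addrC subrK.
apply: cC => //; apply: dC.
have -> : w - z = (1 - t)^-1 *: (y - (t *: x + (1 - t) *: z)).
  by rewrite opprD addrA [RHS]scalerBr [in RHS]scalerA mulVf ?gt_eqF// scale1r.
by rewrite normrZ gtr0_norm ?invr_gt0// mulrC ltr_pdivrMr// mulrC.
Qed.

Lemma convex_interior (C : set X) : convex_subset C -> convex_subset C°.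
Proof.
move=> cC x y t t01 Cx Cy; apply: interior_open_segment => //.
exact: interior_subset.
Qed.

Lemma dual_ext (xs ys : dual X) : (forall x, xs x = ys x) -> xs = ys.
Proof. by move=> xy; apply/val_inj/funext. Qed.

End Interior.

(** * Subgradients of convex functions *)

Section ConvexFunctions.
Context {R : realType} {X : normedModType R}.
Variable h : X -> \bar R.
Hypothesis h_convex : convex_efun h.
Hypothesis h_gtNy : forall x, (-oo < h x)%E.

Lemma dom_fineK x : dom h x -> (fine (h x))%:E = h x.
Proof. by move=> hx; rewrite fineK// fin_real// h_gtNy. Qed.

Lemma epi_dom x (r : R) : (h x <= r%:E)%E -> dom h x.
Proof. by move=> /le_lt_trans; apply; rewrite ltry. Qed.

Lemma epi_fine x (r : R) : (h x <= r%:E)%E -> fine (h x) <= r.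
Proof. by move=> hr; rewrite -lee_fin dom_fineK//; exact: epi_dom hr. Qed.

Lemma dom_epi x : dom h x -> (h x <= (fine (h x))%:E)%E.
Proof. by move=> /dom_fineK ->. Qed.

Lemma epi_convex : convex_rel (fun x (r : R) => (h x <= r%:E)%E).
Proof.
move=> x y r s t t01 xr ys; apply: (le_trans (h_convex x y t01)).
have /andP[t0 t1] := t01.
by rewrite (EFinD (t * _)) !EFinM leeD// lee_wpmul2l// lee_fin ltW// subr_gt0.
Qed.

Lemma dom_convex : convex_subset (dom h).
Proof.
move=> x y t t01 /dom_epi hx /dom_epi hy.
exact: epi_dom (epi_convex t01 hx hy).
Qed.

Lemma subdiff_dom x xs : dom h !=set0 -> subdiff h x xs -> dom h x.
Proof.
move=> [y hy] /(_ y) xxs; rewrite /dom/= ltey; apply/eqP => hx.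
by move: xxs hy; rewrite hx /dom /= addeC/= leye_eq => /eqP ->; rewrite ltxx.
Qed.

(** With [r] ranging over upper bounds of [h y], the subgradient inequality
    lives in [R]. *)
Lemma subdiff_epiP x xs : dom h x -> subdiff h x xs <->
  forall y (r : R), (h y <= r%:E)%E -> xs (y - x) + fine (h x) <= r.
Proof.
move=> hx; split=> [xxs y r yr|xxs y].
  by rewrite -lee_fin EFinD dom_fineK//; exact: le_trans (xxs y) yr.
rewrite -(dom_fineK hx) -EFinD; have := h_gtNy y.
case: (h y) (xxs y) => [r| |]// hr _; last by rewrite leey.
by rewrite lee_fin; exact: hr.
Qed.

(** A subgradient at [y], tested at [x], bounds [h y] by
    [h x + `|ys| * `|x - y|]. This replaces the Baire category argument by
    which convex lower semicontinuous functions are locally bounded. *)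
Lemma convex_near_subdiff_bounded x : subdiff_locally_bounded h ->
  dom h x -> (\forall y \near x, dom_subdiff h y) ->
  exists (d M : R), 0 < d /\ forall y, `|y - x| < d -> (h y <= M%:E)%E.
Proof.
move=> hb hx nx.
have [M nM] := hb _ (nbhs_singleton nx).
have : nbhs x (dom_subdiff h `&`
    [set y | forall ys, subdiff h y ys -> `|ys| <= M]) by exact: filterI.
move=> /nbhs_ballP[d /= d0 dM].
exists d, (fine (h x) + `|M| * d); split=> // y yd.
have [|[ys yys] /(_ _ yys) ysM] := dM y.
  by rewrite -ball_normE /= distrC.
have hy : dom h y by apply: subdiff_dom yys; exists x.
have := (subdiff_epiP ys hy).1 yys _ _ (dom_epi hx).
rewrite -(dom_fineK hy) lee_fin dualB.
have : `|ys (y - x)| <= `|M| * d.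
  apply: (le_trans (le_dual_norm _ _)); apply: ler_pM => //; last exact: ltW.
  exact: le_trans ysM (ler_norm _).
have := ler_norm (ys (y - x)); rewrite dualB; lra.
Qed.

(** Sum rule at a minimizer of [h + g], where [Q] is the epigraph of [g] and
    [b] stands for [g x]: the sandwich theorem separates the epigraph of [h]
    from the hypograph of [h x + b - g]. *)
Lemma fermat_sum (Q : X -> R -> Prop) (z : X) (s0 d M : R) (x : X) (b : R) :
  convex_rel Q -> Q z s0 ->
  0 < d -> (forall y, `|y - z| < d -> (h y <= M%:E)%E) ->
  dom h x -> Q x b ->
  (forall y (r s : R), (h y <= r%:E)%E -> Q y s -> fine (h x) + b <= r + s) ->
  exists xs, subdiff h x xs /\ forall y s, Q y s -> b <= s + xs (y - x).
Proof.
move=> cQ Qz d0 hM hx Qx xmin.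
pose m := fine (h x) + b.
have [||||||xs [c [xsP xsQ]]] := @sandwich R X
  (fun w r => (h w <= r%:E)%E) (fun w s => Q w (s + m)) z (s0 - m) M d.
- exact: epi_convex.
- move=> y w r s t t01 Qy Qw; have := cQ _ _ _ _ _ t01 Qy Qw.
  by congr (Q _ _); ring.
- by move=> w r s hw Qw; have := xmin _ _ _ hw Qw; rewrite /m; lra.
- by rewrite subrK.
- exact: d0.
- exact: hM.
have xsx := xsP _ _ (dom_epi hx).
have xsx' : fine (h x) <= xs x + c.
  by have := xsQ x (- fine (h x)); rewrite opprK; apply; rewrite /m addKr.
exists xs; split.
  apply/subdiff_epiP => // y r /xsP; rewrite dualB; lra.
move=> y s Qy; have := xsQ y (s - m); rewrite subrK => /(_ Qy).
by rewrite dualB /m; lra.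
Qed.

(** The affine function [t |-> h x + t a] on the line [x + R v] lies below
    [h], so it extends to an affine minorant of [h] on the whole space. *)
Lemma ray_subgradient (x v : X) xs (a : R) (z : X) (t0 d M : R) : subdiff h x xs ->
  dom h x -> xs v <= a ->
  (forall t r : R, 0 < t -> (h (x + t *: v)%R <= r%:E)%E ->
    fine (h x) + t * a <= r) ->
  z = x + t0 *: v ->
  0 < d -> (forall y, `|y - z| < d -> (h y <= M%:E)%E) ->
  exists2 xs', subdiff h x xs' & a <= xs' v.
Proof.
move=> xxs hx xsa ha zE d0 hM.
have [||||||xs' [c [xsP xsQ]]] := @sandwich R X
  (fun w r => (h w <= r%:E)%E)
  (fun w s => exists2 t : R, w = x + t *: v & - (fine (h x) + t * a) <= s)
  z (- (fine (h x) + t0 * a)) M d.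
- exact: epi_convex.
- move=> _ _ r s l /andP[l0 l1] [t1 -> rE] [t2 -> sE].
  exists (l * t1 + (1 - l) * t2).
    rewrite !scalerDr addrACA -scalerDl !scalerA -scalerDl.
    by rewrite (_ : l + (1 - l) = 1) ?scale1r//; ring.
  have := ler_wpM2l (ltW l0) rE.
  have : 0 <= 1 - l by lra.
  by move=> /ler_wpM2l/(_ _ _ sE); lra.
- move=> w r s hw [t wE sE].
  have [t_gt0|t_le0] := ltP 0 t.
    by have := ha t r t_gt0; rewrite -wE => /(_ hw); lra.
  have := (subdiff_epiP xs hx).1 xxs _ _ hw.
  by rewrite wE addrAC subrr add0r dualZ; nra.
- by exists t0.
- exact: d0.
- exact: hM.
have xsx := xsP _ _ (dom_epi hx).
have xsx' : fine (h x) <= xs' x + c.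
  have := xsQ x (- fine (h x)); rewrite opprK; apply.
  by exists 0; rewrite ?scale0r ?addr0// mul0r addr0.
exists xs'.
  apply/subdiff_epiP => // y r /xsP; rewrite dualB; lra.
have := xsQ (x + v) (- (fine (h x) + a)); rewrite opprK dualD.
suff: exists2 t : R, x + v = x + t *: v &
    - (fine (h x) + t * a) <= - (fine (h x) + a).
  by move=> /[swap]/[apply]; lra.
by exists 1; rewrite ?scale1r ?mul1r.
Qed.

(** At a boundary point of the domain the outward ray leaves the domain, so a
    subgradient could be made steeper along it; single-valuedness of the
    subdifferential rules this out. *)
Lemma dom_subdiff_interior z (d M : R) x : subdiff_single_valued h ->
  0 < d -> (forall y, `|y - z| < d -> (h y <= M%:E)%E) ->
  dom_subdiff h x -> (dom h)° x.
Proof.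
move=> h1 d0 hM [xs xxs]; apply: contrapT => nx.
have hz : dom h z by apply: epi_dom (hM _ _); rewrite subrr normr0.
have hx : dom h x by apply: subdiff_dom xxs; exists z.
have iz : (dom h)° z.
  by apply/interior_normP; exists d => // y /hM; exact: epi_dom.
have [|||xs' xxs'] := @ray_subgradient x (x - z) xs (xs (x - z) + 1) z (- 1)
  d M xxs hx _ _ _ d0 hM.
- by lra.
- move=> t r t0 /epi_dom hxt; exfalso; apply: nx.
  have t1 : 0 < 1 + t by lra.
  have -> : x = (1 + t)^-1 *: (x + t *: (x - z)) + (1 - (1 + t)^-1) *: z.
    have -> : 1 - (1 + t)^-1 = (1 + t)^-1 * t by field; rewrite gt_eqF.
    rewrite -scalerA -scalerDr -addrA -scalerDr subrK.
    have -> : x + t *: x = (1 + t) *: x by rewrite scalerDl scale1r.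
    by rewrite scalerA mulVf ?scale1r// gt_eqF.
  apply: interior_open_segment => //; first exact: dom_convex.
  by rewrite invr_gt0 t1 invf_lt1//; lra.
- by rewrite scaleN1r opprB addrC subrK.
by rewrite -(h1 _ _ _ xxs xxs'); lra.
Qed.

Lemma gradient_right_quotient x v xs : is_gateaux_gradient h x xs ->
  (fun t : R => t^-1 * (fine (h (t *: v + x)) - fine (h x))) @ 0^'+ --> xs v.
Proof.
move=> /(_ v)[dv Dv]; apply: cvg_dnbhs_at_right.
by rewrite -Dv; exact: dv.
Qed.

Lemma gradient_subdiff x xs : (dom h)° x -> is_gateaux_gradient h x xs ->
  subdiff h x xs.
Proof.
move=> ix gx; have hx : dom h x := interior_subset ix.
apply/subdiff_epiP => // y r hy.
suff : xs (y - x) <= r - fine (h x) by lra.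
apply: (cvgr_to_le (gradient_right_quotient (v := y - x) gx)).
near=> t.
have t0 : 0 < t by near: t; exact: nbhs_right_gt.
have t1 : t < 1 by near: t; apply: nbhs_right_lt.
have -> : t *: (y - x) + x = t *: y + (1 - t) *: x.
  by rewrite scalerBr scalerBl scale1r addrAC addrA.
rewrite ler_pdivrMl// lerBlDr; apply: epi_fine.
have -> : t * (r - fine (h x)) + fine (h x) = t * r + (1 - t) * fine (h x).
  by ring.
by apply: epi_convex => //; [rewrite t0 t1|exact: dom_epi].
Unshelve. all: by end_near. Qed.

Lemma subdiff_gradient x xs g : (dom h)° x -> is_gateaux_gradient h x g ->
  subdiff h x xs -> xs = g.
Proof.
move=> ix gx xxs; have hx : dom h x := interior_subset ix.
have /interior_normP[d d0 dh] := ix.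
have xg v : xs v <= g v.
  have [->|v0] := eqVneq v 0; first by rewrite !dual0.
  apply: (cvgr_to_ge (gradient_right_quotient (v := v) gx)).
  near=> t.
  have t0 : 0 < t by near: t; exact: nbhs_right_gt.
  rewrite ler_pdivlMl//.
  have ht : dom h (t *: v + x).
    apply: dh; rewrite addrK normrZ gtr0_norm//.
    rewrite -ltr_pdivlMr ?normr_gt0//.
    by near: t; apply: nbhs_right_lt; rewrite divr_gt0 ?normr_gt0.
  have := (subdiff_epiP xs hx).1 xxs _ _ (dom_epi ht).
  by rewrite addrK dualZ; lra.
apply: dual_ext => v; apply/eqP; rewrite eq_le xg/=.
by have := xg (- v); rewrite !dualN lerN2.
Unshelve. all: by end_near. Qed.

Lemma gateaux_grad x : gateaux_differentiable h -> (dom h)° x ->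
  is_gateaux_gradient h x (grad h x).
Proof. by move=> [_ hd] /hd ex; rewrite /grad; apply: xgetPex. Qed.

Lemma grad_subdiff x : gateaux_differentiable h -> (dom h)° x ->
  subdiff h x (grad h x).
Proof. by move=> hd ix; apply: gradient_subdiff => //; exact: gateaux_grad. Qed.

Lemma subdiff_grad x xs : gateaux_differentiable h -> (dom h)° x ->
  subdiff h x xs -> xs = grad h x.
Proof. by move=> hd ix; apply: subdiff_gradient => //; exact: gateaux_grad. Qed.

(** If the right slopes of [h] in a direction [w] all exceeded [xs w + e], then
    [ray_subgradient] would produce a second subgradient. *)
Lemma unique_subgradient_gateaux x xs (d M : R) : subdiff h x xs ->
  (forall xs', subdiff h x xs' -> xs' = xs) ->
  0 < d -> (forall y, `|y - x| < d -> (h y <= M%:E)%E) ->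
  is_gateaux_gradient h x xs.
Proof.
move=> xxs xs1 d0 hM v.
have hx : dom h x by apply: epi_dom (hM _ _); rewrite subrr normr0.
have slope w (e : R) : 0 < e -> exists2 t0 : R, 0 < t0 &
    forall t, 0 < t -> t < t0 ->
    xs w <= t^-1 * (fine (h (t *: w + x)) - fine (h x)) <= xs w + e.
  move=> e0.
  have [t0 t00 ht0] : exists2 t0 : R, 0 < t0 &
      (h (x + t0 *: w)%R <= (fine (h x) + t0 * (xs w + e))%:E)%E.
    apply: contrapT => nt.
    have [|||xs' xxs'] := @ray_subgradient x w xs (xs w + e) x 0
      d M xxs hx _ _ _ d0 hM.
    - by lra.
    - move=> t r t0 hr; rewrite leNgt; apply/negP => rlt.
      apply: nt; exists t => //; apply: (le_trans hr).
      by rewrite lee_fin ltW.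
    - by rewrite scale0r addr0.
    by rewrite (xs1 _ xxs'); lra.
  exists t0 => // t t_gt0 tt0.
  have a01 : 0 < t / t0 < 1 by rewrite divr_gt0//= ltr_pdivrMr// mul1r.
  have ht : (h (t *: w + x)%R <= (fine (h x) + t * (xs w + e))%:E)%E.
    have := epi_convex a01 ht0 (dom_epi hx).
    have -> : t / t0 *: (x + t0 *: w) + (1 - t / t0) *: x = t *: w + x.
      rewrite scalerDr scalerA divfK ?gt_eqF// addrAC -scalerDl.
      by rewrite (_ : t / t0 + (1 - t / t0) = 1) ?scale1r 1?addrC//; ring.
    have -> // : t / t0 * (fine (h x) + t0 * (xs w + e)) +
      (1 - t / t0) * fine (h x) = fine (h x) + t * (xs w + e).
    by field; rewrite gt_eqF.
  apply/andP; split.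
    rewrite ler_pdivlMl//.
    have := (subdiff_epiP xs hx).1 xxs _ _ (dom_epi (epi_dom ht)).
    by rewrite addrK dualZ; lra.
  by rewrite ler_pdivrMl//; have := epi_fine ht; lra.
have cv : (fun t : R => t^-1 *: (fine (h (t *: v + x)) - fine (h x) : R^o))
    @ 0^' --> (xs v : R^o).
  apply/cvgrPdist_le => e e0.
  have [s s0 sE] := slope v e e0; have [r r0 rE] := slope (- v) e e0.
  near=> t.
  have ts : `|t| < s by near: t; apply: dnbhs0_lt.
  have tr : `|t| < r by near: t; apply: dnbhs0_lt.
  have [t0|t0|t0] := ltgtP t 0.
  - have nt0 : 0 < - t by rewrite oppr_gt0.
    have ntr : - t < r by rewrite -(ltr0_norm t0).
    have := rE _ nt0 ntr.
    rewrite scalerN scaleNr opprK dualN invrN mulNr.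
    by rewrite ler_norml /= /GRing.scale/=; lra.
  - have ts' : t < s by rewrite -(gtr0_norm t0).
    have := sE _ t0 ts'.
    by rewrite ler_norml /= /GRing.scale/=; lra.
  - by exfalso; move: t0; apply/eqP; near: t; exact: nbhs_dnbhs_neq.
by split; [apply: cvgP cv|exact: cvg_lim cv].
Unshelve. all: by end_near. Qed.

End ConvexFunctions.

(** * Dual spaces *)

Section Dual.
Context {R : realType} {X : normedModType R}.

Lemma dual_complete (F : set_system (dual X)) :
  ProperFilter F -> cauchy F -> cvg F.
Proof.
move=> FF /cauchyP Fc.
have cl (x : X) : exists l : R, (fun xs : dual X => xs x) @ F --> l.
  suff : cvg ((fun xs : dual X => xs x) @ F) by move=> /cvg_ex.
  apply: R_complete; apply/cauchyP => e e0.
  have x10 : 0 < `|x| + 1 by rewrite ltr_wpDl.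
  have [xs Fxs] := Fc _ (divr_gt0 e0 x10).
  exists (xs x).
  suff : \forall ys \near F, ball (xs x) e ((ys : dual X) x) by [].
  apply: filterS Fxs => ys; rewrite -ball_normE /= => xys.
  apply: (le_lt_trans (le_dual_norm (xs - ys) x)).
  rewrite (@le_lt_trans _ _ (e / (`|x| + 1) * `|x|))//.
    by rewrite ler_wpM2r// ltW.
  by rewrite mulrAC ltr_pdivrMr// ltr_pM2l// ltrDl.
have /choice[l xl] := cl.
have near_l (xs : dual X) e : F (ball xs e) -> forall x, `|xs x - l x| <= e * `|x|.
  move=> Fxs x; have [y Fy] := cl x.
  have c : (fun ys : dual X => `|xs x - ys x|) @ F --> `|xs x - l x|.
    by apply: cvg_norm; apply: cvgB; [exact: cvg_cst|exact: xl].
  apply: (cvgr_to_le c); apply: filterS Fxs => ys.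
  rewrite -ball_normE /= => /ltW xys.
  by apply: (le_trans (le_dual_norm (xs - ys) x)); rewrite ler_wpM2r.
have ll : linear (l : X -> R^o).
  move=> a x y.
  have lD : (fun xs : dual X => xs (a *: x + y)) @ F --> (a * l x + l y : R).
    have -> : (fun xs : dual X => xs (a *: x + y)) =
        (fun xs => a * xs x + xs y).
      by apply/funext => xs; rewrite dualD dualZ.
    by apply: cvgD; [apply: cvgMl_tmp; exact: xl|exact: xl].
  exact: (cvg_unique _ (xl (a *: x + y)) lD).
have [xs1 Fxs1] := Fc 1 ltr01.
have [|ls lsl] := @functional_of_linear R X l (`|xs1| + 1) ll.
  move=> x x1; have := near_l _ _ Fxs1 x; have := le_dual_norm xs1 x.
  have : `|xs1| * `|x| <= `|xs1| by rewrite ler_piMr.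
  have := ler_norm (xs1 x); have := ler_norm (l x - xs1 x); rewrite distrC.
  lra.
apply/cvg_ex; exists ls; apply/cvgrPdist_le => e e0.
have [xs Fxs] := Fc _ (divr_gt0 e0 (ltr0Sn R 1)).
apply: filterS (Fxs) => ys xsys.
rewrite -(subrK xs ls) -addrA (le_trans (ler_normD _ _))//.
rewrite [leRHS](splitr e) lerD//; last by apply: ltW; move: xsys; rewrite -ball_normE.
rewrite distrC; apply: dual_normW => x x1.
rewrite (le_trans (ler_norm _))//.
apply: (le_trans (_ : _ <= `|xs x - l x|)); first by rewrite /= -lsl.
apply: (le_trans (near_l _ _ Fxs x)).
by rewrite ler_piMr// ltW// divr_gt0.
Qed.

Lemma bidual_subproof (x : X) : exists xss : dual (dual X), forall xs, xss xs = xs x.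
Proof.
apply: (@functional_of_linear R (dual X) (fun xs => xs x) `|x|) => //.
move=> xs xs1; apply: (le_trans (ler_norm _)).
by apply: (le_trans (le_dual_norm _ _)); rewrite ler_piMl.
Qed.

Definition bidual (x : X) : dual (dual X) := projT1 (cid (bidual_subproof x)).

Lemma bidualE x xs : bidual x xs = xs x.
Proof. exact: (projT2 (cid (bidual_subproof x))). Qed.

Lemma bidual_norm x : `|bidual x| <= `|x|.
Proof.
apply: dual_normW => xs xs1; rewrite bidualE (le_trans (ler_norm _))//.
by rewrite (le_trans (le_dual_norm _ _))// ler_piMl.
Qed.

Lemma dual_reflexive : reflexive_space X -> reflexive_space (dual X).
Proof.
move=> rX xsss.
have [||xs xsE] := @functional_of_linear R X (fun x => xsss (bidual x)) `|xsss|.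
- move=> a x y; rewrite /GRing.scale/= -dualZ -dualD; congr (xsss _).
  apply: dual_ext => xs.
  have -> : (a *: bidual x + bidual y) xs = a * bidual x xs + bidual y xs by [].
  by rewrite !bidualE dualD dualZ.
- move=> x x1; rewrite (le_trans (ler_norm _))// (le_trans (le_dual_norm _ _))//.
  by rewrite ler_piMr//; exact: le_trans (bidual_norm x) x1.
exists xs => xss; have [x xssx] := rX xss.
rewrite xssx xsE; congr (xsss _); apply: dual_ext => ys.
by rewrite bidualE xssx.
Qed.

(** Uniform boundedness principle on the dual, which is complete, for the
    evaluations at the points of [F]. *)
Lemma weakly_bounded_bounded (F : set X) :
  (forall xs : dual X, exists M : R, forall x, F x -> xs x <= M) ->
  exists M : R, forall x, F x -> `|x| <= M.
Proof.
move=> Fb.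
pose V : completeNormedModType R := HB.pack (dual X : Type)
  (NormedModule.on (dual X)) (Uniform_isComplete.Build (dual X) dual_complete).
pose G : set (V -> R^o) := [set (bidual x : V -> R^o) | x in F].
have Gbl g : G g -> bounded_fun_norm g /\ linear g.
  move=> [x _ <-]; split=> [r|]; last by move=> a xs ys; exact: linearP.
  exists (r * `|x|) => xs xsr; rewrite bidualE.
  by rewrite (le_trans (le_dual_norm _ _))// ler_wpM2r.
have Gpt : pointwise_bounded G.
  move=> xs; have [M1 FM1] := Fb xs; have [M2 FM2] := Fb (- (xs : dual X)).
  exists (Num.max M1 M2) => _ [x Fx <-]; rewrite bidualE le_max.
  case: (ger0P (xs x)) => _; first by rewrite FM1.
  by rewrite (FM2 _ Fx : - xs x <= M2) orbT.
have [M FM] := Banach_Steinhauss Gbl Gpt 1.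
exists M => x Fx; have [xs [xs1 <-]] := norming_functional x.
rewrite -bidualE (le_trans (ler_norm _))//.
have Fbx : G (bidual x) by exists x.
apply: (FM _ Fbx xs).
by apply: dual_normW => y y1; exact: le_trans (xs1 y) y1.
Qed.

End Dual.

(** * Conjugate functions *)

Section Conjugate.
Context {R : realType} {X : normedModType R}.
Implicit Types xs ys : dual X.
Variable h : X -> \bar R.
Hypothesis h_gtNy : forall x, (-oo < h x)%E.

Lemma conjugate_leP xs (c : R) : (conjugate h xs <= c%:E)%E <->
  forall y (r : R), (h y <= r%:E)%E -> xs y - r <= c.
Proof.
split=> [hc y r yr|hc].
  rewrite -lee_fin; apply: le_trans hc.
  apply: (@le_trans _ _ ((xs y)%:E - h y)%E).
    by rewrite EFinB leeB.
  by apply: ereal_sup_ubound; exists y.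
apply: ge_ereal_sup => _ [y _ <-].
case: (h y) (h_gtNy y) (hc y) => [r| |]// _ hr; last by rewrite addeNy leNye.
by rewrite -EFinB lee_fin hr.
Qed.

Lemma conjugate_ge x xs : dom h x ->
  ((xs x - fine (h x))%:E <= conjugate h xs)%E.
Proof.
move=> hx; apply: ereal_sup_ubound; exists x => //.
by rewrite EFinB (dom_fineK h_gtNy).
Qed.

Hypothesis h_dom : dom h !=set0.

Lemma conjugate_gtNy xs : (-oo < conjugate h xs)%E.
Proof.
have [x hx] := h_dom; apply: lt_le_trans (conjugate_ge xs hx).
by rewrite ltNyr.
Qed.

Lemma conjugate_convex : convex_efun (conjugate h).
Proof.
move=> xs ys t /andP[t0 t1].
have s0 : 0 < 1 - t by rewrite subr_gt0.
have := conjugate_leP xs; have := conjugate_leP ys.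
case: (conjugate h xs) (conjugate_gtNy xs) => [a| |]// _; last first.
  rewrite gt0_muley ?lte_fin// addye ?leey//.
  case: (conjugate h ys) (conjugate_gtNy ys) => [b| |]// _.
  by rewrite gt0_muley ?lte_fin.
case: (conjugate h ys) (conjugate_gtNy ys) => [b| |]// _; last first.
  by rewrite [((1 - t)%:E * _)%E]gt0_muley ?lte_fin// addey ?leey.
move=> /(_ b)[/(_ (lexx _)) yb _] /(_ a)[/(_ (lexx _)) xa _].
apply/conjugate_leP => z r zr.
have -> : (t *: xs + (1 - t) *: ys) z = t * xs z + (1 - t) * ys z by [].
have := ler_wpM2l (ltW t0) (xa _ _ zr); have := ler_wpM2l (ltW s0) (yb _ _ zr).
lra.
Qed.

Lemma conjugate_subdiff x xs : dom h x -> subdiff h x xs ->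
  conjugate h xs = (xs x - fine (h x))%:E.
Proof.
move=> hx xxs; apply/eqP; rewrite eq_le conjugate_ge// andbT.
apply/conjugate_leP => y r yr.
have := (subdiff_epiP h_gtNy xs hx).1 xxs _ _ yr; rewrite dualB; lra.
Qed.

Lemma subdiff_of_conjugate_le x xs : dom h x ->
  (conjugate h xs <= (xs x - fine (h x))%:E)%E -> subdiff h x xs.
Proof.
move=> hx /conjugate_leP xxs; apply/subdiff_epiP => // y r /xxs.
by rewrite dualB; lra.
Qed.

Lemma subdiff_conjugate x xs : dom h x -> subdiff h x xs ->
  subdiff (conjugate h) xs (bidual x).
Proof.
move=> hx xxs ys; rewrite (conjugate_subdiff hx xxs) bidualE -EFinD.
apply: le_trans (conjugate_ge ys hx); rewrite lee_fin.
have -> : (ys - xs) x = ys x - xs x by [].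
lra.
Qed.

End Conjugate.

(** * Lower semicontinuous convex functions *)

Section LowerSemicontinuity.
Context {R : realType} {X : normedModType R}.
Implicit Types xs ys : dual X.
Variable h : X -> \bar R.
Hypothesis h_lsc : lower_semicontinuous h.

Lemma closed_sublevel (xs : dual X) (c : R) :
  closed [set w | (h w <= (xs w + c)%:E)%E].
Proof.
rewrite -[X in closed X]setCK; apply: open_closedC; rewrite openE => w /= hw.
have {hw} hw : ((xs w + c)%:E < h w)%E by rewrite ltNge; exact/negP.
have [a wa ah] : exists2 a : R, xs w + c < a & (a%:E < h w)%E.
  case: (h w) hw => [r| |]//; last by exists (xs w + c + 1); rewrite ?ltry//; lra.
  by rewrite lte_fin => wr; exists ((xs w + c + r) / 2); rewrite ?lte_fin; lra.
have [V wV Vh] := h_lsc ah.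
have near_xs : \forall y \near w, xs y + c < a.
  have : xs y @[y --> w] --> xs w by exact: bounded_operator_continuous.
  move=> /cvgr_lt/(_ (a - c)); rewrite ltrBrDr => /(_ wa).
  by apply: filterS => y; rewrite ltrBrDr.
apply: filterS2 near_xs wV => y ya Vy /=.
apply/negP; rewrite -ltNge; apply: lt_trans (Vh _ Vy).
by rewrite lte_fin.
Qed.

Hypothesis h_convex : convex_efun h.
Hypothesis h_gtNy : forall x, (-oo < h x)%E.

Lemma convex_sublevel (xs : dual X) (c : R) :
  convex_subset [set w | (h w <= (xs w + c)%:E)%E].
Proof.
move=> x y t t01 /= hx hy.
have := epi_convex h_convex t01 hx hy.
rewrite dualD !dualZ (_ : t * xs x + (1 - t) * xs y + c =
  t * (xs x + c) + (1 - t) * (xs y + c))//; ring.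
Qed.

(** A maximizing sequence for [xs - h] is bounded: finiteness of the conjugate
    at [xs + t *: ys], for small [t > 0], bounds it above along [ys], for
    every [ys]. Its weak limits are maximizers, since sublevel sets of
    [h - xs] are weakly closed. *)
Lemma conjugate_attained xs : dom h !=set0 ->
  reflexive_space X -> (dom (conjugate h))° xs ->
  exists2 x, dom h x & subdiff h x xs.
Proof.
move=> hd rX ixs.
have c_gtNy := conjugate_gtNy h_gtNy hd.
have xsd : dom (conjugate h) xs := interior_subset ixs.
pose m := fine (conjugate h xs).
have mE : conjugate h xs = m%:E by rewrite (dom_fineK c_gtNy).
pose F := [set w | exists2 r : R, (h w <= r%:E)%E & m - 1 <= xs w - r].
have [M FM] : exists M : R, forall w, F w -> `|w| <= M.
  apply: weakly_bounded_bounded => ys.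
  have /interior_normP[d d0 dd] := ixs.
  pose t := d / (`|ys| + 1).
  have y1 : 0 < `|ys| + 1 by rewrite ltr_wpDl.
  have t0 : 0 < t by rewrite divr_gt0.
  have : dom (conjugate h) (xs + t *: ys).
    apply: dd; rewrite addrAC subrr add0r normrZ gtr0_norm//.
    by rewrite mulrAC ltr_pdivrMr// ltr_pM2l// ltrDl.
  move=> /(dom_epi c_gtNy)/(conjugate_leP h_gtNy).
  set b := fine _ => hb.
  exists (t^-1 * (b - (m - 1))) => w [r wr mr].
  rewrite ler_pdivlMl//; have := hb _ _ wr.
  have -> : (xs + t *: ys) w = xs w + t * ys w by [].
  lra.
have near_max n : exists w, exists2 r : R, (h w <= r%:E)%E &
    m - n.+1%:R^-1 <= xs w - r.
  apply: contrapT => nw.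
  have : (conjugate h xs <= (m - n.+1%:R^-1)%:E)%E.
    apply/(conjugate_leP h_gtNy) => w r wr.
    rewrite leNgt; apply/negP => lt_m; apply: nw.
    by exists w, r => //; exact: ltW.
  by rewrite mE lee_fin leNgt ltrBlDr ltrDl invr_gt0 ltr0Sn.
have /choice[u uP] := near_max.
have uM n : `|u n| <= M.
  apply: FM; have [r hr mr] := uP n; exists r => //.
  by apply: le_trans mr; rewrite lerB// invf_le1// ler1n.
have [U [UU ooU]] := @ultraFilterLemma nat \oo _.
have [x ux] := weak_lim_exists rX UU uM.
have hle (e : R) : 0 < e -> (h x <= (xs x + (e - m))%:E)%E.
  move=> e0; have := weak_lim_closed_convex (@closed_sublevel xs (e - m))
    (@convex_sublevel xs (e - m)) _ ux; apply.
  apply: ooU; near=> n.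
  have [r hr mr] := uP n; apply: (le_trans hr); rewrite lee_fin.
  have n1e : (n.+1%:R^-1 : R) < e by near: n; exact: near_infty_natSinv_lt (PosNum e0).
  by move: mr n1e; set k := (_^-1); lra.
have hx : dom h x := epi_dom (hle 1 ltr01).
exists x => //; apply: (subdiff_of_conjugate_le h_gtNy hx).
rewrite mE lee_fin; apply/ler_addgt0Pr => e e0.
have := hle _ e0; rewrite -(dom_fineK h_gtNy hx) lee_fin; lra.
Unshelve. all: by end_near. Qed.

(** Fenchel-Moreau, in the form needed here. The sandwich theorem is applied to
    [h] and to a steep affine function on the segment from [x0] to a point [z]
    near which [h] is bounded: it starts above [a] at [x0], where lower
    semicontinuity keeps [h] above [a] for a while, and falls below the
    minorant provided by a subgradient at [z] before that while has elapsed. *)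
Lemma affine_minorant_gt z gz (d M : R) x0 (a : R) :
  0 < d -> (forall y, `|y - z| < d -> (h y <= M%:E)%E) ->
  subdiff h z gz -> (a%:E < h x0)%E ->
  exists (ys : dual X) (c : R), (forall w (r : R), (h w <= r%:E)%E ->
    ys w + c <= r) /\ a < ys x0 + c.
Proof.
move=> d0 hM zgz ah.
have hz : dom h z by apply: epi_dom (hM _ _); rewrite subrr normr0.
have [b ab bh] : exists2 b : R, a < b & (b%:E < h x0)%E.
  case: (h x0) ah => [r| |]//; last by exists (a + 1); rewrite ?ltry//; lra.
  by rewrite lte_fin => ar; exists ((a + r) / 2); rewrite ?lte_fin; lra.
have [V /nbhs_ballP[e /= e0 eV] Vh] := h_lsc bh.
have n1 : 0 < `|z - x0| + 1 by rewrite ltr_wpDl.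
(* [h] exceeds [b] on the part [t < t0] of the segment from [x0] to [z] *)
pose t0 := e / (`|z - x0| + 1).
have t00 : 0 < t0 by rewrite divr_gt0.
pose b0 := gz (x0 - z) + fine (h z).
pose B := `|b0| + `|fine (h z)|.
(* [- B] bounds the minorant given by [gz] on the whole segment, and [K] is the
   slope that brings [b] down to at most [- B] at [t = t0] *)
pose K := (`|b| + B) / t0.
have B0 : 0 <= `|b| + B by rewrite addr_ge0// addr_ge0.
have K0 : 0 <= K by apply: divr_ge0 => //; exact: ltW.
have [v vE] : exists v, v = z - x0 by exists (z - x0).
have [||||||ys [c [ysP ysQ]]] := @sandwich R X
  (fun w r => (h w <= r%:E)%E)
  (fun w s => exists t : R,
    [/\ 0 <= t <= 1, w = x0 + t *: v & - (b - t * K) <= s])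
  z (- (b - K)) M d.
- exact: epi_convex.
- move=> _ _ r s l /andP[l0 l1] [t1 [/andP[t10 t11] -> rE]]
    [t2 [/andP[t20 t21] -> sE]].
  have l1' : 0 <= 1 - l by lra.
  exists (l * t1 + (1 - l) * t2); split.
  - by apply/andP; split; nra.
  - rewrite !scalerDr addrACA -scalerDl !scalerA -scalerDl.
    by rewrite (_ : l + (1 - l) = 1) ?scale1r//; ring.
  have := ler_wpM2l (ltW l0) rE.
  by have := ler_wpM2l l1' sE; lra.
- move=> w r s hw [t [/andP[tge0 tle1] wE sE]].
  have [tt0|t0t] := ltP t t0.
    have Vw : V w.
      apply: eV; rewrite -ball_normE /= wE vE opprD addNKr normrN normrZ ger0_norm//.
      rewrite (@le_lt_trans _ _ (t0 * `|z - x0|))//.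
        by rewrite ler_wpM2r// ltW.
      by rewrite mulrAC ltr_pdivrMr// ltr_pM2l// ltrDl.
    have : b <= r by rewrite -lee_fin ltW// (lt_le_trans (Vh _ Vw)).
    nra.
  have := (subdiff_epiP h_gtNy gz hz).1 zgz _ _ hw.
  have -> : w - z = (1 - t) *: (x0 - z).
    rewrite wE vE scalerBl scale1r -(opprB z x0) scalerN opprK.
    by rewrite addrAC opprB.
  rewrite dualZ.
  have Kt : `|b| + B <= t * K.
    by rewrite /K mulrCA -[leLHS]mulr1 ler_wpM2l// ler_pdivlMr// mul1r.
  have := ler_norm b; have := ler_norm (- b0); have := ler_norm (- fine (h z)).
  rewrite !normrN => h1 h2 h3.
  have : - B <= (1 - t) * b0 + t * fine (h z).
    rewrite /B; have := normr_ge0 b0; have := normr_ge0 (fine (h z)).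
    nra.
  by rewrite /b0; lra.
- exists 1; split; rewrite ?ler01 ?lexx//; last by rewrite mul1r.
  by rewrite scale1r vE addrC subrK.
- exact: d0.
- exact: hM.
exists ys, c; split=> //; apply: (lt_le_trans ab).
have := ysQ x0 (- b); rewrite opprK; apply; exists 0; split.
- by rewrite lexx ler01.
- by rewrite scale0r addr0.
- by rewrite mul0r subr0.
Qed.

(** An affine minorant of [h] that exceeds [xs x - conjugate h xs] at [x] would
    contradict the subgradient inequality for the conjugate. *)
Lemma subdiff_of_conjugate z gz (d M : R) x xs :
  0 < d -> (forall y, `|y - z| < d -> (h y <= M%:E)%E) ->
  subdiff h z gz -> dom (conjugate h) xs ->
  subdiff (conjugate h) xs (bidual x) -> subdiff h x xs.
Proof.
move=> d0 hM zgz xsd xsx.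
have hz : dom h z by apply: epi_dom (hM _ _); rewrite subrr normr0.
have hd : dom h !=set0 by exists z.
have c_gtNy := conjugate_gtNy h_gtNy hd.
have hle : (h x <= (xs x - fine (conjugate h xs))%:E)%E.
  rewrite leNgt; apply/negP => /(affine_minorant_gt d0 hM zgz)[ys [c [ysc]]].
  have ysd : (conjugate h ys <= (- c)%:E)%E.
    by apply/(conjugate_leP h_gtNy) => w r /ysc; lra.
  have := (subdiff_epiP c_gtNy (bidual x) xsd).1 xsx _ _ ysd.
  by rewrite bidualE (_ : (ys - xs) x = ys x - xs x)//; lra.
have hx := epi_dom hle.
apply: (subdiff_of_conjugate_le h_gtNy hx).
rewrite -(dom_fineK c_gtNy xsd) lee_fin.
by move: hle; rewrite -(dom_fineK h_gtNy hx) lee_fin; lra.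
Qed.

End LowerSemicontinuity.

(** * Legendre functions *)

Section Legendre.
Context {R : realType} {X : normedModType R}.
Variable f : X -> \bar R.
Hypothesis f_Legendre : Legendre f.

Let f_lsc : lower_semicontinuous f. Proof. by case: f_Legendre => -[]. Qed.
Let f_convex : convex_efun f. Proof. by case: f_Legendre => -[]. Qed.
Let f_gtNy : forall x, (-oo < f x)%E. Proof. by case: f_Legendre => -[]. Qed.
Let f_dom : dom f !=set0. Proof. by case: f_Legendre => -[]. Qed.
Let f_diff : gateaux_differentiable f. Proof. by case: f_Legendre. Qed.

Lemma legendre_bounded_near z : (dom f)° z ->
  exists (d M : R), 0 < d /\ forall y, `|y - z| < d -> (f y <= M%:E)%E.
Proof.
move=> iz; have [_ _ [fb _] _] := f_Legendre.
apply: convex_near_subdiff_bounded => //; first exact: interior_subset.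
apply: filterS (nbhs_interior iz) => y iy.
by exists (grad f y); exact: grad_subdiff.
Qed.

Lemma legendre_dom_subdiff x : dom_subdiff f x -> (dom f)° x.
Proof.
have [_ [[z /legendre_bounded_near[d [M [d0 fM]]]] _] [_ f1] _] := f_Legendre.
exact: (dom_subdiff_interior f_convex f_gtNy f1 d0 fM).
Qed.

Lemma legendre_grad x xs : subdiff f x xs -> (dom f)° x /\ xs = grad f x.
Proof.
move=> xxs; have ix : (dom f)° x by apply: legendre_dom_subdiff; exists xs.
by split=> //; exact: subdiff_grad.
Qed.

(** Otherwise [f] would be at least its chord at the midpoint of [x] and [y],
    by adding the subgradient inequalities at the two ends. *)
Lemma legendre_strict x y : (dom f)° x -> (dom f)° y ->
  grad f x (x - y) = grad f y (x - y) -> x = y.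
Proof.
move=> ix iy gxy; apply/eqP; apply: contrapT => /negP xy.
have [_ _ _ [_ /(_ (dom f)°) strict]] := f_Legendre.
have fx : dom f x := interior_subset ix.
have fy : dom f y := interior_subset iy.
have cvx : convex_set ((dom f)° : set (convex_lmodType X)).
  apply/convex_setW => u v; rewrite !inE => iu iv k k0 k1; rewrite inE.
  by apply: convex_interior => //; [exact: dom_convex|rewrite k0 k1].
have sub : (dom f)° `<=` dom_subdiff f.
  by move=> u iu; exists (grad f u); exact: grad_subdiff.
have h01 : 0 < (2^-1 : R) < 1 by rewrite invr_gt0 invf_lt1// ltr1n ltr0n.
have := strict cvx sub x y _ ix iy xy h01.
rewrite -(dom_fineK f_gtNy fx) -(dom_fineK f_gtNy fy) -!EFinM -EFinD => fw.
have /(subdiff_epiP f_gtNy (grad f x) fx) xP := grad_subdiff f_convex f_gtNy f_diff ix.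
have /(subdiff_epiP f_gtNy (grad f y) fy) yP := grad_subdiff f_convex f_gtNy f_diff iy.
set w := _ *: x + _ in fw; have wd : dom f w by apply: lt_trans fw _; rewrite ltry.
have := xP _ _ (dom_epi f_gtNy wd); have := yP _ _ (dom_epi f_gtNy wd).
have -> : w - y = 2^-1 *: (x - y).
  rewrite /w scalerBr (_ : 1 - 2^-1 = 2^-1 :> R); last by field.
  rewrite -addrA; congr (_ + _); rewrite -[X in _ - X]scale1r -scalerBl -scaleNr.
  by congr (_ *: _); field.
have -> : w - x = - (2^-1 *: (x - y)).
  rewrite /w scalerBr (_ : 1 - 2^-1 = 2^-1 :> R); last by field.
  rewrite opprB addrAC -[X in _ - X]scale1r -scalerBl addrC; congr (_ + _).
  by rewrite -scaleNr; congr (_ *: _); field.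
rewrite dualN !dualZ gxy.
move: fw; rewrite -(dom_fineK f_gtNy wd) lte_fin; lra.
Qed.

Hypothesis X_reflexive : reflexive_space X.

(** The conjugate is finite near [grad f x], so it is subdifferentiable there
    and bounded; its subgradients are points of [X] by reflexivity, and strict
    convexity of [f] leaves only [x]. *)
Lemma legendre_conjugate_grad x : (dom f)° x ->
  (dom (conjugate f))° (grad f x) ->
  grad (conjugate f) (grad f x) = bidual x.
Proof.
move=> ix ixs; have [_ _ _ [cb _]] := f_Legendre.
have fx : dom f x := interior_subset ix.
have c_gtNy := conjugate_gtNy f_gtNy f_dom.
have c_convex := conjugate_convex f_gtNy f_dom.
have xxs := grad_subdiff f_convex f_gtNy f_diff ix.
have cx := subdiff_conjugate f_gtNy fx xxs.
have [||d [M [d0 cM]]] := convex_near_subdiff_bounded c_gtNy cb (x := grad f x).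
- exact: interior_subset ixs.
- apply: filterS (nbhs_interior ixs) => ys iys.
  have [y fy yys] := conjugate_attained f_lsc f_convex f_gtNy f_dom X_reflexive iys.
  by exists (bidual y); exact: subdiff_conjugate.
have [e [N [e0 fN]]] := legendre_bounded_near ix.
have gx : is_gateaux_gradient (conjugate f) (grad f x) (bidual x).
  apply: (unique_subgradient_gateaux c_convex c_gtNy cx _ d0 cM) => xss xxss.
  have [y yE] := X_reflexive xss.
  have xssE : xss = bidual y by apply: dual_ext => ys; rewrite bidualE yE.
  rewrite xssE in xxss *; congr bidual.
  have := subdiff_of_conjugate f_lsc f_convex f_gtNy e0 fN xxs
    (interior_subset ixs) xxss.
  move=> /legendre_grad[iy gy]; apply/esym/legendre_strict => //.
  by rewrite gy.
apply/esym; apply: (subdiff_gradient c_gtNy ixs) => //.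
by rewrite /grad; apply: xgetPex; exists (bidual x).
Qed.

End Legendre.

(** * Uniqueness of weak limits *)

Section WeakUniqueness.
Context {R : realType} {X : normedModType R}.

Lemma dual_separates (x y : X) : (forall xs : dual X, xs x = xs y) -> x = y.
Proof.
move=> xy; have [xs [_ xsE]] := norming_functional (x - y).
apply/eqP; rewrite -subr_eq0 -normr_eq0 -xsE dualB xy subrr//.
Qed.

Lemma weak_lim_unique (U : set_system nat) {FU : ProperFilter U}
    (u : nat -> X) x y : weak_lim U u x -> weak_lim U u y -> x = y.
Proof.
move=> ux uy; apply: dual_separates => xs.
exact: (cvg_unique _ (ux xs) (uy xs)).
Qed.

Lemma cvg_extraction (k : nat -> nat) : (forall n, (n <= k n)%N) ->
  k @ \oo --> \oo.
Proof.
move=> kn A [N _ NA]; exists N => // n /= Nn; apply: NA => /=.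
exact: leq_trans Nn (kn n).
Qed.

Lemma weakly_cvg_of_ultra (u : nat -> X) x :
  (forall U : set_system nat, UltraFilter U -> \oo `<=` U -> weak_lim U u x) ->
  weakly_cvg u x.
Proof.
by move=> uU xs; apply: (@cvg_of_ultra R^o) => U UU ooU; exact: uU.
Qed.

End WeakUniqueness.

(** * Bregman distances *)

Section Bregman.
Context {R : realType} {X : normedModType R}.
Variable h : X -> \bar R.
Hypothesis h_convex : convex_efun h.
Hypothesis h_gtNy : forall x, (-oo < h x)%E.
Hypothesis h_diff : gateaux_differentiable h.

(** Real-valued Bregman distance, faithful to [bregman] when [x] is in the domain
    of [h] and [y] in its interior; see [bregmanE]. *)
Definition rbregman x y : R := fine (h x) - fine (h y) - grad h y (x - y).

Lemma bregmanE x y : dom h x -> (dom h)° y -> bregman h x y = (rbregman x y)%:E.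
Proof.
move=> hx iy; rewrite /bregman asboolT// /rbregman !EFinB.
by rewrite !(dom_fineK h_gtNy)//; exact: interior_subset.
Qed.

Lemma rbregman_ge0 x y : dom h x -> (dom h)° y -> 0 <= rbregman x y.
Proof.
move=> hx iy; have hy : dom h y := interior_subset iy.
have := (subdiff_epiP h_gtNy _ hy).1 (grad_subdiff h_convex h_gtNy h_diff iy) _ _
  (dom_epi h_gtNy hx).
by rewrite /rbregman; lra.
Qed.

Lemma rbregman_three_points z x y :
  grad h y (z - x) - grad h x (z - x) =
  rbregman z x + rbregman x y - rbregman z y.
Proof. by rewrite /rbregman !dualB; ring. Qed.

End Bregman.

(** * The forward-backward step *)

Section Prox.
Context {R : realType} {X : normedModType R}.
Variables (f phi : X -> \bar R).
Hypothesis f_Legendre : Legendre f.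
Hypothesis phi_Gamma0 : Gamma0 phi.

Let f_convex : convex_efun f. Proof. by case: f_Legendre => -[]. Qed.
Let f_gtNy : forall x, (-oo < f x)%E. Proof. by case: f_Legendre => -[]. Qed.
Let f_diff : gateaux_differentiable f. Proof. by case: f_Legendre. Qed.
Let phi_convex : convex_efun phi. Proof. by case: phi_Gamma0. Qed.
Let phi_gtNy : forall x, (-oo < phi x)%E. Proof. by case: phi_Gamma0. Qed.

(** The point [x] minimizes [f + (g phi - xs)]. By the sum rule [f] has a
    subgradient at [x], which forces [x] into the interior of the domain, where
    that subgradient is the gradient. *)
Lemma prox_variational (g : R) (xs : dual X) x z : 0 < g ->
  (dom f)° z -> dom phi z ->
  prox f (fun w => g%:E * phi w)%E xs x ->
  [/\ (dom f)° x, dom phi x & forall y, dom phi y ->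
    g * fine (phi x) - xs x <= g * fine (phi y) - xs y + grad f x (y - x)].
Proof.
move=> g0 iz phiz [xfin xmin].
have fz : dom f z := interior_subset iz.
have [phix fx] : dom phi x /\ dom f x.
  move: xfin; rewrite /dom/=.
  case: (phi x) (phi_gtNy x) => [a| |]// _; last first.
    by rewrite gt0_muley ?lte_fin//; case: (f x) (f_gtNy x).
  by case: (f x) (f_gtNy x) => [b| |]// _; rewrite !ltry.
have [d [M [d0 fM]]] := legendre_bounded_near f_Legendre iz.
pose Q w (s : R) := (phi w <= ((s + xs w) / g)%:E)%E.
have QE w : dom phi w -> Q w (g * fine (phi w) - xs w).
  by move=> phiw; rewrite /Q subrK mulrC mulKf ?gt_eqF// (dom_fineK phi_gtNy).
have cQ : convex_rel Q.
  move=> u v r s t t01 Qu Qv; rewrite /Q.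
  have := epi_convex phi_convex t01 Qu Qv.
  by congr (_ <= _%:E)%E; rewrite dualD !dualZ; field; rewrite gt_eqF.
have [|gx [xgx gxQ]] := fermat_sum f_convex f_gtNy cQ (QE _ phiz) d0 fM fx (QE _ phix).
  move=> w r s fw Qw; have phiw := epi_dom Qw.
  have fwd := epi_dom fw.
  have := xmin w; rewrite -(dom_fineK phi_gtNy phix) -(dom_fineK phi_gtNy phiw).
  rewrite -(dom_fineK f_gtNy fx) -(dom_fineK f_gtNy fwd).
  rewrite -!EFinM -!EFinD lee_fin => /= xw.
  have := epi_fine phi_gtNy Qw; rewrite ler_pdivlMr// => hQ.
  have := epi_fine f_gtNy fw; lra.
have [ix gxE] := legendre_grad f_Legendre xgx.
split=> // y phiy; rewrite -gxE; exact: gxQ (QE _ phiy).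
Qed.

End Prox.

Section ForwardBackwardStep.
Context {R : realType} {X Y : normedModType R}.
Variables (phi : X -> \bar R) (psi : Y -> \bar R) (L : bounded_operator X Y).
Variables (f : X -> \bar R) (beta : R).
Hypothesis phi_Gamma0 : Gamma0 phi.
Hypothesis psi_Gamma0 : Gamma0 psi.
Hypothesis psi_diff : gateaux_differentiable psi.
Hypothesis f_Legendre : Legendre f.
Hypothesis L_int_dom : L @` (dom f)° `<=` (dom psi)°.
Hypothesis f_dominates : bregman_dominates f beta psi L.

Let F x : R := fine (phi x) + fine (psi (L x)).

(** Expand the gradients of [f] and [psi] in the variational inequality of the
    proximal point into Bregman distances. The domination hypothesis absorbs
    [g * D_psi (L xp) (L x)] into [D_f xp x]. *)
Lemma forward_backward_step (g : R) x xp z0 :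
  0 < g -> g <= beta -> (dom f)° x -> (dom f)° z0 -> dom phi z0 ->
  prox f (fun w => g%:E * phi w)%E (grad f x - g *: adjoint L (grad psi (L x))) xp ->
  [/\ (dom f)° xp, dom phi xp & forall z, dom f z -> dom phi z -> dom psi (L z) ->
    g * (F xp - F z) + rbregman f z xp <= rbregman f z x].
Proof.
move=> g0 gb ix iz0 phiz0 xpP.
have [[_ f_convex f_gtNy _] f_diff _ _] := f_Legendre.
have [_ psi_convex psi_gtNy _] := psi_Gamma0.
have [ixp phixp var] := prox_variational f_Legendre phi_Gamma0 g0 iz0 phiz0 xpP.
split=> // z fz phiz psiz.
have := var z phiz.
have iL y : (dom f)° y -> (dom psi)° (L y) by move=> iy; apply: L_int_dom; exists y.
have xsE w : (grad f x - g *: adjoint L (grad psi (L x))) w =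
  grad f x w - g * grad psi (L x) (L w) by [].
rewrite !xsE => vz.
have := f_dominates (interior_subset ixp) ix.
rewrite (bregmanE f_gtNy (interior_subset ixp) ix).
rewrite (bregmanE psi_gtNy (interior_subset (iL _ ixp)) (iL _ ix)).
rewrite -EFinM lee_fin => dm.
have D0 := rbregman_ge0 f_convex f_gtNy f_diff (interior_subset ixp) ix.
have E0 := rbregman_ge0 psi_convex psi_gtNy psi_diff psiz (iL _ ix).
have gE : g * rbregman psi (L xp) (L x) <= rbregman f xp x.
  have [P0|P0] := leP (rbregman psi (L xp) (L x)) 0.
    by apply: le_trans D0; rewrite pmulr_rle0.
  by apply: le_trans dm; rewrite ler_pM2r.
have gE0 : 0 <= g * rbregman psi (L z) (L x) by rewrite mulr_ge0// ltW.
have three := rbregman_three_points f z xp x.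
have psiE : g * (rbregman psi (L z) (L x) - rbregman psi (L xp) (L x)) =
  g * (fine (psi (L z)) - fine (psi (L xp)))
  - (g * grad psi (L x) (L z) - g * grad psi (L x) (L xp)).
  by rewrite /rbregman !dualB; ring.
rewrite !dualB in three; rewrite dualB in vz.
rewrite /F; move: gE gE0 psiE three vz.
move: (rbregman _ _ _) (rbregman _ _ _) (rbregman _ _ _) (rbregman _ _ _) (rbregman _ _ _).
move=> a1 a2 a3 a4 a5.
move: (g * grad psi (L x) (L z)) (g * grad psi (L x) (L xp)) => b1 b2.
move: (grad f x z) (grad f x xp) (grad f xp z) (grad f xp xp) => c1 c2 c3 c4.
move: (fine _) (fine _) (fine _) (fine _) => e1 e2 e3 e4.
lra.
Qed.

End ForwardBackwardStep.

(** * Weak limits of sequences in the interior of the domain *)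

Section WeakClusterPoints.
Context {R : realType} {X : normedModType R}.
Variables (f : X -> \bar R) (x : nat -> X) (M : R).
Hypothesis f_Legendre : Legendre f.
Hypothesis X_reflexive : reflexive_space X.
Hypothesis x_int : forall n, (dom f)° (x n).
Hypothesis xM : forall n, `|x n| <= M.

Let f_lsc : lower_semicontinuous f. Proof. by case: f_Legendre => -[]. Qed.
Let f_convex : convex_efun f. Proof. by case: f_Legendre => -[]. Qed.
Let f_gtNy : forall x, (-oo < f x)%E. Proof. by case: f_Legendre => -[]. Qed.
Let f_dom : dom f !=set0. Proof. by case: f_Legendre => -[]. Qed.
Let f_diff : gateaux_differentiable f. Proof. by case: f_Legendre. Qed.

(** The pairing [grad f (x n) (z1 - z2)] is, up to a constant, the difference of
    the two Bregman distances, so it converges; its limit is computed along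
    subsequences converging weakly to [z1] and to [z2]. *)
Lemma weak_cluster_points_equal U1 U2 z1 z2 (l1 l2 : R) :
  grad_weakly_seq_continuous f ->
  UltraFilter U1 -> \oo `<=` U1 -> weak_lim U1 x z1 -> (dom f)° z1 ->
  UltraFilter U2 -> \oo `<=` U2 -> weak_lim U2 x z2 -> (dom f)° z2 ->
  rbregman f z1 (x n) @[n --> \oo] --> l1 ->
  rbregman f z2 (x n) @[n --> \oo] --> l2 -> z1 = z2.
Proof.
move=> wsc UU1 ooU1 xz1 iz1 UU2 ooU2 xz2 iz2 D1 D2.
pose c := fine (f z1) - fine (f z2) - (l1 - l2).
have gc : grad f (x n) (z1 - z2) @[n --> \oo] --> (c : R).
  have -> : (fun n => grad f (x n) (z1 - z2)) = (fun n =>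
      fine (f z1) - fine (f z2) - (rbregman f z1 (x n) - rbregman f z2 (x n))).
    by apply/funext => n; rewrite /rbregman !dualB; ring.
  by apply: cvgB; [exact: cvg_cst|exact: cvgB].
have grad_c U z : UltraFilter U -> \oo `<=` U -> weak_lim U x z -> (dom f)° z ->
    grad f z (z1 - z2) = c.
  move=> UU ooU xz iz.
  have [k [kn xk]] := eberlein_smulian X_reflexive UU ooU xM xz.
  have := wsc _ _ (fun n => x_int (k n)) iz xk (bidual (z1 - z2)).
  rewrite bidualE => gk.
  have gk' : grad f (x (k n)) (z1 - z2) @[n --> \oo] --> (c : R).
    exact: (cvg_comp _ _ (cvg_extraction kn) gc).
  apply: (cvg_unique _ _ gk') => //.
  have -> // : (fun n => grad f (x (k n)) (z1 - z2)) =
      (fun n => bidual (z1 - z2) (grad f ((x \o k) n))).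
  by apply/funext => n; rewrite bidualE.
apply: (legendre_strict f_Legendre iz1 iz2).
by rewrite (grad_c U1 z1)// (grad_c U2 z2).
Qed.

(** The gradients [grad f (x n)] are bounded: their conjugate values exceed
    their values at [w] by at most a constant, while [f] is bounded near [w].
    A weak limit [ys] of them has a finite conjugate value, so [ys] is interior
    to the domain of the conjugate and is the gradient of [f] at some
    interior point [y]. As the gradient of the conjugate sends [grad f (x n)]
    back to [x n] and [ys] to [y], its weak continuity gives [z = y]. *)
Lemma weak_cluster_point_interior U z w (C : R) :
  open (dom (conjugate f)) -> grad_weakly_seq_continuous (conjugate f) ->
  UltraFilter U -> \oo `<=` U -> weak_lim U x z ->
  (dom f)° w -> (forall n, rbregman f w (x n) <= C) -> (dom f)° z.
Proof.
move=> cop cwsc UU ooU xz iw wC.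
have c_gtNy := conjugate_gtNy f_gtNy f_dom.
have [k1 [k1n xk1]] := eberlein_smulian X_reflexive UU ooU xM xz.
have gsub n : subdiff f (x n) (grad f (x n)) by exact: grad_subdiff.
have xd n : dom f (x n) := interior_subset (x_int n).
pose C' := C - fine (f w).
have gP n y (r : R) : (f y <= r%:E)%E -> grad f (x n) (y - w) <= C' + r.
  move=> fy; have := (subdiff_epiP f_gtNy _ (xd n)).1 (gsub n) _ _ fy.
  by have := wC n; rewrite /rbregman !dualB /C'; lra.
have [d [N [d0 fN]]] := legendre_bounded_near f_Legendre iw.
have gM n : `|grad f (x n)| <= (d / 2)^-1 * (C' + N).
  have d20 : 0 < d / 2 by rewrite divr_gt0.
  apply: dual_normW => v v1; rewrite ler_pdivlMl// -dualZ.
  rewrite -[X in grad f (x n) X](addrK w); apply: gP; apply: fN.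
  rewrite addrK normrZ gtr0_norm//.
  apply: (@le_lt_trans _ _ (d / 2)); last by rewrite ltr_pdivrMr//; lra.
  by rewrite ler_piMr// ltW.
have [ys gys] := weak_lim_exists (u := fun n => grad f (x (k1 n)))
   (dual_reflexive X_reflexive) UU (fun n => gM (k1 n)).
have [k2 [k2n gk2]] := eberlein_smulian (u := fun n => grad f (x (k1 n)))
   (dual_reflexive X_reflexive) UU ooU (fun n => gM (k1 n)) gys.
have ysd : dom (conjugate f) ys.
  apply: (epi_dom (r := C' + ys w)).
  apply/(conjugate_leP f_gtNy) => y r fy.
  suff : ys (y - w) <= C' + r by rewrite dualB; lra.
  rewrite -bidualE; apply: (cvgr_to_le (gk2 (bidual (y - w)))).
  by apply: filterE => n /=; rewrite bidualE; exact: gP.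
have ci : (dom (conjugate f))° = dom (conjugate f) by exact: ((interior_id _).1 cop).
have iys : (dom (conjugate f))° ys by rewrite ci.
have [y fy yys] :=
  conjugate_attained f_lsc f_convex f_gtNy f_dom X_reflexive iys.
have [iy ysE] := legendre_grad f_Legendre yys.
have ign n : (dom (conjugate f))° (grad f (x n)).
  rewrite ci; apply: (epi_dom (r := grad f (x n) (x n) - fine (f (x n)))).
  by rewrite (conjugate_subdiff f_gtNy (xd n) (gsub n)).
have xy : weak_lim \oo (fun n => x (k1 (k2 n))) y.
  move=> xs; have := cwsc _ _ (fun n => ign (k1 (k2 n))) iys gk2 (bidual xs).
  rewrite ysE (legendre_conjugate_grad f_Legendre X_reflexive iy) -?ysE//.
  rewrite !bidualE.
  have -> // : (fun n => bidual xs (grad (conjugate f) (grad f (x (k1 (k2 n))))))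
      = (fun n => xs (x (k1 (k2 n)))).
  apply/funext => n.
  by rewrite (legendre_conjugate_grad f_Legendre X_reflexive)// !bidualE.
have xz2 : weak_lim \oo (fun n => x (k1 (k2 n))) z.
  by move=> xs; exact: (cvg_comp _ _ (cvg_extraction k2n) (xk1 xs)).
by rewrite (weak_lim_unique xz2 xy).
Qed.

End WeakClusterPoints.

(** * Sublevel sets of the objective *)

Section ClosedConvexHelpers.
Context {R : realType} {X : normedModType R}.

Lemma convex_closure (C : set X) : convex_subset C -> convex_subset (closure C).
Proof.
move=> cC x y t t01 /closure_normP Cx /closure_normP Cy.
apply/closure_normP => e e0.
have [u Cu xu] := Cx _ e0; have [v Cv yv] := Cy _ e0.
exists (t *: u + (1 - t) *: v); first exact: cC.
have /andP[t0 t1] := t01; have s0 : 0 < 1 - t by rewrite subr_gt0.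
rewrite opprD addrACA -!scalerBr (le_lt_trans (ler_normD _ _))//.
rewrite !normrZ (gtr0_norm t0) (gtr0_norm s0).
have -> : e = t * e + (1 - t) * e by ring.
by apply: ltrD; rewrite ltr_pM2l.
Qed.

Context {Y : normedModType R}.
Variables (phi : X -> \bar R) (psi : Y -> \bar R) (L : bounded_operator X Y).
Hypothesis phi_Gamma0 : Gamma0 phi.
Hypothesis psi_Gamma0 : Gamma0 psi.

Let phi_gtNy : forall x, (-oo < phi x)%E. Proof. by case: phi_Gamma0. Qed.
Let psi_gtNy : forall x, (-oo < psi x)%E. Proof. by case: psi_Gamma0. Qed.

Lemma sum_comp_lsc : lower_semicontinuous (fun x => phi x + psi (L x))%E.
Proof.
have [phi_lsc _ _ _] := phi_Gamma0; have [psi_lsc _ _ _] := psi_Gamma0.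
move=> x c hc.
have [a [b [ha hb abc]]] : exists a b : R,
    [/\ (a%:E < phi x)%E, (b%:E < psi (L x))%E & c <= a + b].
  case: (phi x) (phi_gtNy x) hc => [r| |]// _;
    case: (psi (L x)) (psi_gtNy (L x)) => [s| |]// _.
  - rewrite -EFinD lte_fin => hc.
    exists (r - (r + s - c) / 2), (s - (r + s - c) / 2).
    by split; rewrite ?lte_fin; lra.
  - by move=> _; exists (r - 1), (c - (r - 1)); split; rewrite ?lte_fin ?ltry//; lra.
  - by move=> _; exists (c - (s - 1)), (s - 1); split; rewrite ?lte_fin ?ltry//; lra.
  - by move=> _; exists c, 0; split; rewrite ?ltry//; lra.
have [V xV Vphi] := phi_lsc _ _ ha; have [W xW Wpsi] := psi_lsc _ _ hb.
exists (V `&` L @^-1` W).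
  by apply: filterI => //; exact: (@bounded_operator_continuous _ _ _ L x).
move=> y [Vy Wy]; apply: (@le_lt_trans _ _ (a%:E + b%:E)%E).
  by rewrite -EFinD lee_fin.
by apply: lteD; [exact: Vphi|exact: Wpsi].
Qed.

Lemma sum_comp_finP x (c : R) : (phi x + psi (L x) <= c%:E)%E ->
  [/\ dom phi x, dom psi (L x) & fine (phi x) + fine (psi (L x)) <= c].
Proof.
rewrite /dom/=; case: (phi x) (phi_gtNy x) => [r| |]// _;
  case: (psi (L x)) (psi_gtNy (L x)) => [s| |]// _.
by rewrite -EFinD lee_fin !ltry.
Qed.

Lemma sum_comp_fin x : dom phi x -> dom psi (L x) ->
  (phi x + psi (L x))%E = (fine (phi x) + fine (psi (L x)))%:E.
Proof.
by move=> hx hLx; rewrite EFinD (dom_fineK phi_gtNy)// (dom_fineK psi_gtNy).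
Qed.

Lemma sum_comp_sublevel_convex (c : R) :
  convex_subset [set x | (phi x + psi (L x) <= c%:E)%E].
Proof.
have [_ phi_cv _ _] := phi_Gamma0; have [_ psi_cv _ _] := psi_Gamma0.
move=> x y t t01 /sum_comp_finP[px sx xc] /sum_comp_finP[py sy yc] /=.
have := leeD (epi_convex phi_cv t01 (dom_epi phi_gtNy px) (dom_epi phi_gtNy py))
  (epi_convex psi_cv t01 (dom_epi psi_gtNy sx) (dom_epi psi_gtNy sy)).
rewrite linearD !linearZ => /le_trans; apply; rewrite -EFinD lee_fin.
have /andP[t0 t1] := t01; have s0 : 0 <= 1 - t by lra.
have := ler_wpM2l (ltW t0) xc; have := ler_wpM2l s0 yc; lra.
Qed.

End ClosedConvexHelpers.

(** * Strong convergence *)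

Section StrongConvergence.
Context {R : realType} {X : normedModType R}.

Lemma cvg_of_dist0 (y : nat -> X) xb :
  `|xb - y n| @[n --> \oo] --> (0 : R) -> y @ \oo --> xb.
Proof.
move=> y0; apply/cvgrPdist_lt => e e0.
have /cvgr0_norm_lt/(_ _ e0) := y0.
by apply: filterS => n; rewrite normr_id.
Qed.

Lemma half_itv01 : 0 < (2^-1 : R) < 1.
Proof. by rewrite invr_gt0 invf_lt1// ltr1n ltr0n. Qed.

Lemma convex_midpoint (h : X -> \bar R) x y :
  convex_efun h -> (forall x, (-oo < h x)%E) -> dom h x -> dom h y ->
  2 * fine (h (2^-1 *: x + (1 - 2^-1) *: y)) <= fine (h x) + fine (h y).
Proof.
move=> h_cv h_gtNy hx hy.
have := epi_fine h_gtNy (epi_convex h_cv half_itv01 (dom_epi h_gtNy hx)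
  (dom_epi h_gtNy hy)).
lra.
Qed.

(** The modulus at [`|xb - y n|] is at most [2 * e n]; being monotone and positive
    away from 0, it cannot tend to 0 unless its argument does. *)
Lemma uniformly_convex_at_cvg (h : X -> \bar R) xb (y : nat -> X) (e : nat -> R) :
  convex_efun h -> (forall x, (-oo < h x)%E) -> uniformly_convex_at h xb ->
  (forall n, dom h (y n)) ->
  (forall n, fine (h xb) + fine (h (y n))
     - 2 * fine (h (2^-1 *: xb + (1 - 2^-1) *: y n)) <= e n) ->
  e @ \oo --> (0 : R) -> `|xb - y n| @[n --> \oo] --> (0 : R).
Proof.
move=> h_cv h_gtNy [hxb [mu [mu_ge0 mu_mono mu0 hmu]]] hy he e0.
have h01 := half_itv01.
have mue n : (mu `|xb - y n|%R <= (2 * e n)%:E)%E.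
  have := hmu (y n) 2^-1 (hy n) h01; have := he n.
  have wd := dom_convex h_cv h_gtNy h01 hxb (hy n).
  rewrite -(dom_fineK h_gtNy wd) -(dom_fineK h_gtNy hxb) -(dom_fineK h_gtNy (hy n)).
  rewrite /= -!EFinM -!EFinD.
  have := mu_ge0 _ (normr_ge0 (xb - y n)).
  case: (mu _) => [r| |]// _.
    by rewrite -EFinM -EFinD !lee_fin; lra.
  rewrite gt0_muley ?lte_fin; first by rewrite addey// leye_eq.
  by case/andP: h01 => h0 h1; rewrite mulr_gt0// subr_gt0.
apply/cvgrPdist_lt => s s0.
have [d d0 ds] : exists2 d : R, 0 < d & (d%:E <= mu s)%E.
  have := mu_ge0 _ (ltW s0); have := mu0 _ (ltW s0).
  case: (mu s) => [r| |]// [r0 _]; last by exists 1; rewrite ?leey.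
  rewrite lee_fin le_eqVlt => /orP[/eqP r00|]; last by exists r.
  by move: s0; rewrite r0 ?ltxx// -r00.
have d20 : 0 < d / 2 by rewrite divr_gt0.
have /cvgr0_norm_lt/(_ _ d20) := e0.
apply: filterS => n en; rewrite sub0r normrN normr_id ltNge; apply/negP => sn.
have := le_trans ds (le_trans (mu_mono _ _ (ltW s0) sn) (mue n)).
by rewrite lee_fin; move: en; have := ler_norm (e n); lra.
Qed.

Variables (f : X -> \bar R) (x : nat -> X) (M : R).
Hypothesis f_Legendre : Legendre f.
Hypothesis x_int : forall n, (dom f)° (x n).
Hypothesis xM : forall n, `|x n| <= M.

(** Moving only a fraction [1 / (2 + |z - x n|)] of the way from [x n] to [z]
    keeps the point interior and within distance 1, while convexity does not
    increase the Bregman distance; the sequential condition applies to the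
    shortened segments and controls the original ones. *)
Lemma bregman_small_dist : bregman_seq_condition f ->
  forall e : R, 0 < e -> exists2 d : R, 0 < d &
    forall z n, dom f z -> rbregman f z (x n) < d -> `|z - x n| < e.
Proof.
have [[_ f_cv f_gtNy _] f_diff _ _] := f_Legendre.
move=> fseq e e0; apply: contrapT => nd.
have bad k : exists zn : X * nat, [/\ dom f zn.1,
    rbregman f zn.1 (x zn.2) < k.+1%:R^-1 & e <= `|zn.1 - x zn.2|].
  apply: contrapT => nk; apply: nd; exists k.+1%:R^-1; first by rewrite invr_gt0.
  move=> z n fz zn; rewrite ltNge; apply/negP => ezn; apply: nk.
  by exists (z, n).
have /choice[zn znP] := bad.
pose v k := x (zn k).2.
pose d k := `|(zn k).1 - v k|.
have d0 k : 0 <= d k by exact: normr_ge0.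
have d2 k : 0 < 2 + d k by rewrite ltr_wpDr.
pose t k := (2 + d k)^-1.
have t01 k : 0 < t k < 1.
  by rewrite /t invr_gt0 d2 invf_lt1// ltr_wpDr// ltr1n.
pose u k := t k *: (zn k).1 + (1 - t k) *: v k.
have iu k : (dom f)° (u k).
  by apply: interior_open_segment => //; [exact: dom_convex|case: (znP k)|exact: x_int].
have uv k : u k - v k = t k *: ((zn k).1 - v k).
  by rewrite /u scalerBl scale1r scalerBr addrAC addrA subrK.
have normuv k : `|u k - v k| = t k * d k.
  by rewrite uv normrZ gtr0_norm//; case/andP: (t01 k).
have td1 k : t k * d k <= 1.
  by rewrite /t mulrC ler_pdivrMr// mul1r lerDr.
have bv : bounded_fun v.
  exists M; split=> [|r Mr k _]; first exact: num_real.
  exact: le_trans (xM _) (ltW Mr).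
have bu : bounded_fun u.
  exists (1 + M); split=> [|r Mr k _]; first exact: num_real.
  apply: le_trans (ltW Mr); rewrite -(subrK (v k) (u k)).
  by rewrite (le_trans (ler_normD _ _))// lerD ?xM// normuv.
have Duv k : rbregman f (u k) (v k) <= k.+1%:R^-1.
  have [fz /ltW Dz _] := znP k; have fv : dom f (v k) := interior_subset (x_int _).
  have fu := epi_convex f_cv (t01 k) (dom_epi f_gtNy fz) (dom_epi f_gtNy fv).
  have := epi_fine f_gtNy fu; rewrite -/(u k) => {}fu.
  have /andP[t0 t1] := t01 k.
  apply: (@le_trans _ _ (t k * rbregman f (zn k).1 (v k))).
    by rewrite /rbregman uv dualZ; lra.
  apply: le_trans Dz; rewrite ler_piMl//; last exact: ltW.
  by apply: rbregman_ge0 => //; exact: x_int.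
have := fseq u v iu (fun k => x_int _) bu bv.
have Duv0 : bregman f (u n) (v n) @[n --> \oo] --> 0%E.
  have -> : (fun n => bregman f (u n) (v n)) =
      (fun n => (rbregman f (u n) (v n))%:E).
    apply/funext => n; rewrite bregmanE//; last exact: x_int.
    exact: interior_subset (iu n).
  apply/fine_cvgP; split; first by apply: filterE.
  apply: (@squeeze_cvgr _ _ _ _ (fun=> 0) (fun n => n.+1%:R^-1)) => /=.
  - apply: filterE => n; rewrite Duv andbT rbregman_ge0//; last exact: x_int.
    exact: interior_subset (iu n).
  - exact: cvg_cst.
  - exact: cvg_harmonic.
move=> /(_ Duv0) /cvgr0_norm_lt.
have ee : 0 < e / (2 + e) by rewrite divr_gt0// ltr_pwDl// ltW.
move=> /(_ _ ee)[k _ /(_ k (leqnn k))] /=; rewrite normuv /t mulrC.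
rewrite ltr_pdivrMr// mulrAC ltr_pdivlMr; last by lra.
by have [_ _] := znP k; rewrite -/(v k) -/(d k); lra.
Qed.

End StrongConvergence.

(** * Convergence of the Bregman forward-backward method *)

Unset Implicit Arguments.

Theorem theorem3p2 (R : realType) (X Y : completeNormedModType R)
  (X_reflexive : reflexive_space X) (Y_reflexive : reflexive_space Y)
  (phi : X -> \bar R) (psi : Y -> \bar R) (L : bounded_operator X Y)
  (phi_Gamma0 : Gamma0 phi)
  (psi_Gamma0 : Gamma0 psi) (psi_diff : gateaux_differentiable psi)
  (S : set X) (S_def : S = minimizers (fun x => phi x + psi (L x))%E)
  (f : X -> \bar R) (f_Legendre : Legendre f)
  (S_int_dom : S `&` (dom f)° !=set0)
  (L_int_dom : L @` (dom f)° `<=` (dom psi)°)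
  (beta : R) (beta_gt0 : 0 < beta)
  (f_dominates : bregman_dominates f beta psi L)
  (f_cofinite_or : cofinite f \/
     [set - adjoint L ys | ys in grad psi @` (dom psi)°]
       `<=` dom (conjugate phi))
  (Df_coercive : forall x, (dom f)° x -> coercive (bregman f x))
  (eps : R) (eps_bounds : 0 < eps < beta / (beta + 1))
  (eta : nat -> R) (eta_ge0 : forall n, 0 <= eta n)
  (eta_summable : cvgn (series eta))
  (gamma : nat -> R)
  (gamma_bounds : forall n, eps <= gamma n <= beta * (1 - eps))
  (gamma_eta : forall n,
     (1 + eta n) * gamma n - gamma n.+1 <= beta * eta n)
  (x : nat -> X) (x0_int_dom : (dom f)° (x 0%N))
  (x_iter : forall n,
     prox f (fun z => (gamma n)%:E * phi z)%E
       (grad f (x n) - gamma n *: adjoint L (grad psi (L (x n))))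
     = [set x n.+1]) :
  exists xbar : X,
    [/\ S xbar,
        [\/ exists z, S `&` closure (dom f) = [set z],
            [/\ grad_weakly_seq_continuous f,
                grad_weakly_seq_continuous psi & S `<=` (dom f)°] |
            [/\ open (dom (conjugate f)),
                grad_weakly_seq_continuous f,
                grad_weakly_seq_continuous (conjugate f) &
                grad_weakly_seq_continuous psi]] ->
        weakly_cvg x xbar &
        bregman_seq_condition f ->
        [\/ uniformly_convex_at phi xbar,
            uniformly_convex_at psi (L xbar) /\
              (exists kappa : R, 0 < kappa /\
                 forall z : X, kappa * `|z| <= `|L z|) |
            limn_einf (fun n => bregman_set f S (x n)) = 0%E] ->
        x @ \oo --> xbar].
Proof.
have [[f_lsc f_cv f_gtNy f_dom] f_diff _ _] := f_Legendre.
have [phi_lsc phi_cv phi_gtNy _] := phi_Gamma0.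
have [psi_lsc psi_cv psi_gtNy _] := psi_Gamma0.
have /andP[eps0 _] := eps_bounds.
pose F z : R := fine (phi z) + fine (psi (L z)).
have S_dom z : S z -> dom phi z /\ dom psi (L z).
  rewrite S_def => -[zfin _]; have := zfin; rewrite fin_numD.
  by move=> /andP[pfin sfin]; rewrite /dom /= !ltey_eq pfin sfin.
have S_min z y : S z -> dom phi y -> dom psi (L y) -> F z <= F y.
  move=> Sz py sy; have [pz sz] := S_dom z Sz.
  move: Sz; rewrite S_def => -[_ /(_ y)].
  by rewrite !(sum_comp_fin phi_Gamma0 psi_Gamma0)// lee_fin.
have [z0 [Sz0 iz0]] := S_int_dom.
have [pz0 sz0] := S_dom _ Sz0.
have g0 n : 0 < gamma n.
  by have /andP[eg _] := gamma_bounds n; exact: lt_le_trans eg.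
have gb n : gamma n <= beta.
  have /andP[_ /le_trans] := gamma_bounds n; apply.
  by rewrite ler_piMr ?gerBl ?ltW.
have step n : (dom f)° (x n) -> [/\ (dom f)° (x n.+1), dom phi (x n.+1) &
    forall z, dom f z -> dom phi z -> dom psi (L z) ->
    gamma n * (F (x n.+1) - F z) + rbregman f z (x n.+1) <= rbregman f z (x n)].
  move=> ix; apply: (forward_backward_step phi_Gamma0 psi_Gamma0 psi_diff
    f_Legendre L_int_dom f_dominates (g0 n) (gb n) ix iz0 pz0).
  by rewrite x_iter.
have x_int n : (dom f)° (x n).
  by elim: n => // n /step[].
have x_phi n : dom phi (x n.+1) by have [] := step n (x_int n).
have x_psi n : dom psi (L (x n)).
  by apply: interior_subset; apply: L_int_dom; exists (x n).
have x_dom n : dom f (x n) := interior_subset (x_int n).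
have descent z n : S z -> dom f z ->
    eps * (F (x n.+1) - F z) + rbregman f z (x n.+1) <= rbregman f z (x n).
  move=> Sz fz; have [pz sz] := S_dom _ Sz.
  have [_ _ /(_ z fz pz sz)] := step n (x_int n); apply: le_trans.
  rewrite lerD2r; apply: ler_wpM2r; last by have /andP[] := gamma_bounds n.
  by rewrite subr_ge0; exact: S_min.
have Dge0 z n : dom f z -> 0 <= rbregman f z (x n).
  by move=> fz; exact: rbregman_ge0.
have Ddecr z : S z -> dom f z -> nonincreasing_seq (fun n => rbregman f z (x n)).
  move=> Sz fz; apply/nonincreasing_seqP => n; have := descent z n Sz fz.
  have : 0 <= eps * (F (x n.+1) - F z).
    by apply: mulr_ge0; [exact: ltW|rewrite subr_ge0; exact: S_min].
  by lra.
have Dcvg z : S z -> dom f z -> cvgn (fun n => rbregman f z (x n)).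
  move=> Sz fz; apply: nonincreasing_is_cvgn; first exact: Ddecr.
  by exists 0 => _ [n _ <-]; exact: Dge0.
have fz0 : dom f z0 := interior_subset iz0.
have DC n : rbregman f z0 (x n) <= rbregman f z0 (x 0%N) by exact: Ddecr.
have [M xM] : exists M, forall n, `|x n| <= M.
  have [b bx] := Df_coercive z0 iz0 (rbregman f z0 (x 0%N) + 1).
  exists b => n; rewrite leNgt; apply/negP => bn.
  have := bx _ (ltW bn); rewrite (bregmanE f_gtNy fz0 (x_int n)) lee_fin.
  by have := DC n; lra.
pose m := F z0.
have Fm n : m <= F (x n.+1) by exact: S_min.
have F_cvg : F (x n.+1) - m @[n --> \oo] --> (0 : R).
  have [l Dl] := (cvg_ex _).1 (Dcvg _ Sz0 fz0).
  have Dl' : rbregman f z0 (x n.+1) @[n --> \oo] --> (l : R).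
    by move: Dl; rewrite -cvg_shiftS.
  have dD : eps^-1 * (rbregman f z0 (x n) - rbregman f z0 (x n.+1))
      @[n --> \oo] --> (0 : R).
    have -> : 0 = eps^-1 * (l - l) by rewrite subrr mulr0.
    by apply: cvgMl_tmp; exact: cvgB.
  apply: (@squeeze_cvgr _ _ _ _ (fun=> 0)) dD; last exact: cvg_cst.
  apply: filterE => n; rewrite subr_ge0 Fm/= ler_pdivlMl//.
  by have := descent z0 n Sz0 fz0; rewrite -/m; lra.
have cluster U z : UltraFilter U -> \oo `<=` U -> weak_lim U x z ->
    S z /\ closure (dom f) z.
  move=> UU ooU xz; split; last first.
    apply: (weak_lim_closed_convex (@closed_closure _ _) _ _ xz).
      by apply: convex_closure; exact: dom_convex.
    by apply: filterE => n; exact: subset_closure.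
  have Fz (e : R) : 0 < e -> (phi z + psi (L z) <= (m + e)%:E)%E.
    move=> e0.
    have cl : closed [set w | (phi w + psi (L w) <= (m + e)%:E)%E].
      have -> : [set w | (phi w + psi (L w) <= (m + e)%:E)%E] =
          [set w | (phi w + psi (L w) <= ((0 : dual X) w + (m + e))%:E)%E].
        apply/funext => w /=.
        by rewrite (_ : (0 : dual X) w + (m + e) = m + e)// -[RHS]add0r.
      exact/closed_sublevel/sum_comp_lsc.
    apply: (weak_lim_closed_convex cl _ _ xz).
      exact: sum_comp_sublevel_convex.
    apply: ooU; have /cvgr0_norm_lt/(_ _ e0)[N _ NF] := F_cvg.
    exists N.+1 => // -[//|n] Nn /=.
    rewrite (sum_comp_fin phi_Gamma0 psi_Gamma0)// lee_fin -/(F _).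
    have := NF n Nn; rewrite /= => /(le_lt_trans (ler_norm _)); lra.
  have [pz sz _] := sum_comp_finP phi_Gamma0 psi_Gamma0 (Fz 1 ltr01).
  rewrite S_def; split; first by rewrite (sum_comp_fin phi_Gamma0 psi_Gamma0).
  move=> y; apply: (@le_trans _ _ m%:E).
    apply/lee_addgt0Pr => e e0; rewrite -EFinD; exact: Fz.
  have := Sz0; rewrite S_def => -[_ /(_ y)].
  by rewrite [X in (X <= _)%E -> _](sum_comp_fin phi_Gamma0 psi_Gamma0).
have [U0 [UU0 ooU0]] := @ultraFilterLemma nat \oo _.
have [xbar xxbar] := weak_lim_exists X_reflexive UU0 xM.
have [Sxbar clxbar] := cluster _ _ UU0 ooU0 xxbar.
have [pxbar sxbar] := S_dom _ Sxbar.
exists xbar; split => //.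
- move=> hyp; apply: weakly_cvg_of_ultra => U UU ooU.
  have [z xz] := weak_lim_exists X_reflexive UU xM.
  have [Sz clz] := cluster _ _ UU ooU xz.
  suff -> : xbar = z by [].
  have eq_int : grad_weakly_seq_continuous f -> (dom f)° xbar -> (dom f)° z ->
      xbar = z.
    move=> wsc ixbar iz.
    have [l1 D1] := (cvg_ex _).1 (Dcvg _ Sxbar (interior_subset ixbar)).
    have [l2 D2] := (cvg_ex _).1 (Dcvg _ Sz (interior_subset iz)).
    exact: (weak_cluster_points_equal f_Legendre X_reflexive x_int xM wsc
      UU0 ooU0 xxbar ixbar UU ooU xz iz D1 D2).
  case: hyp => [[y Sy]|[fwsc _ Sint]|[cop fwsc cwsc _]].
  + have yE w : S w -> closure (dom f) w -> w = y.
      by move=> Sw clw; have : (S `&` closure (dom f)) w by []; rewrite Sy.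
    by rewrite (yE _ Sxbar clxbar) (yE _ Sz clz).
  + by apply: eq_int => //; exact: Sint.
  + have int z' U' UU' ooU' xz' := weak_cluster_point_interior f_Legendre
      X_reflexive x_int xM (U := U') (z := z') cop cwsc UU' ooU' xz' iz0 DC.
    by apply: eq_int => //; [exact: int xxbar|exact: int xz].
move=> fseq hyp.
have h01 := @half_itv01 R.
pose mid n := 2^-1 *: xbar + (1 - 2^-1) *: x n.+1.
have pmid n : dom phi (mid n) by exact: dom_convex.
have Lmid n : L (mid n) = 2^-1 *: L xbar + (1 - 2^-1) *: L (x n.+1).
  by rewrite /mid linearD !linearZ.
have smid n : dom psi (L (mid n)) by rewrite Lmid; exact: dom_convex.
have Fmid n : m <= F (mid n) by exact: S_min.
have Fxbar : F xbar = m.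
  by apply/eqP; rewrite eq_le !S_min.
have phi_mid n : 2 * fine (phi (mid n)) <= fine (phi xbar) + fine (phi (x n.+1)).
  exact: convex_midpoint.
have psi_mid n : 2 * fine (psi (L (mid n))) <=
    fine (psi (L xbar)) + fine (psi (L (x n.+1))).
  by rewrite Lmid; exact: convex_midpoint.
case: hyp => [phi_uc|[psi_uc [kappa [kappa0 Lk]]]|liminf0].
- rewrite -cvg_shiftS; apply: cvg_of_dist0.
  apply: (uniformly_convex_at_cvg phi_cv phi_gtNy phi_uc x_phi _ F_cvg) => n.
  have := psi_mid n; have := Fmid n; rewrite -/(mid n).
  by move: Fxbar; rewrite /F; lra.
- rewrite -cvg_shiftS; apply: cvg_of_dist0.
  have Lcvg : `|L xbar - L (x n.+1)| @[n --> \oo] --> (0 : R).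
    apply: (uniformly_convex_at_cvg psi_cv psi_gtNy psi_uc
      (y := fun n => L (x n.+1)) _ _ F_cvg) => // n.
    have := phi_mid n; have := Fmid n; rewrite -Lmid.
    by move: Fxbar; rewrite /F; lra.
  have Lcvg' : kappa^-1 * `|L xbar - L (x n.+1)| @[n --> \oo] --> (0 : R).
    by rewrite -(mulr0 kappa^-1); apply: cvgMl_tmp.
  apply: (@squeeze_cvgr _ _ _ _ (fun=> 0)) Lcvg'; last exact: cvg_cst.
  apply: filterE => n; rewrite normr_ge0/= ler_pdivlMl//.
  by rewrite -linearB; exact: Lk.
have [l xl] : exists l : X, x @ \oo --> l.
  suff : cvg (x @ \oo) by move=> /cvg_ex.
  apply: cauchy_cvg; apply/cauchyP => e e0.
  have [d d0 dP] := bregman_small_dist f_Legendre x_int xM fseq e0.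
  have [N] : exists N, (bregman_set f S (x N) < d%:E)%E.
    apply: contrapT => nN.
    have : (d%:E <= limn_einf (fun n => bregman_set f S (x n)))%E.
      rewrite limn_einf_lim; apply: lime_ge; first exact: is_cvg_einfs.
      apply: filterE => n; apply: le_ereal_inf_tmp => _ [k _ <-].
      by rewrite leNgt; apply/negP => kd; apply: nN; exists k.
    by rewrite liminf0 lee_fin leNgt d0.
  move=> /ereal_inf_lt[_ [z Sz <-] zd].
  have fz : dom f z.
    move: zd; rewrite /bregman asboolT// /dom/=.
    by rewrite -(dom_fineK f_gtNy (x_dom N)); case: (f z) (f_gtNy z).
  rewrite (bregmanE f_gtNy fz (x_int N)) lte_fin in zd.
  exists z; exists N => // n /= Nn; rewrite -ball_normE /=.
  by apply: dP => //; apply: le_lt_trans zd; exact: Ddecr.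
suff -> : xbar = l by [].
apply: (weak_lim_unique xxbar) => xs; apply: cvg_trans (cvg_app _ ooU0) _.
by apply: cvg_comp xl _; exact: bounded_operator_continuous.
Qed.
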